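(* When the number of voters $m$ is a constant, the constructive and destructive control variants of Real Value Perception Manipulation (RVPM) can be solved in polynomial time under the $l_2$ norm for arbitrary scoring rules.
   Context: Spatial election model: $n$ candidates $c_1,\dots,c_n$ and $m$ voters $v_1,\dots,v_m$ are points of $\mathbb R^d$. Each voter ranks candidates by increasing Euclidean distance; closest ranked 1; original rankings have no ties. A scoring rule is a non-increasing $f:\{1,\dots,n\}\to\mathbb R$: a candidate ranked $t$ by a voter receives $f(t)$; totals summed; highest total wins. Given $\epsilon>0$, an adversary may replace target $c_1$ by any $\tilde c_1\in\mathbb R^d$ with $\|\tilde c_1-c_1\|_2\le\epsilon$; ties created by the manipulation are broken in the adversary's favor. Constructive control: decide whether some such $\tilde c_1$ makes $c_1$ win (with $c_1$ placed ahead of equidistant candidates, its total is at least every other's). Destructive control: decide whether some such $\tilde c_1$ makes $c_1$ lose (with $c_1$ placed behind equidistant candidates, some other candidate's total is at least $c_1$'s). *)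

(* Defs.v *)
From Stdlib Require Import Reals ZArith List Arith.
Open Scope R_scope.

(* Candidates are indexed 0..n-1 (index 0 is the target c_1), voters   *)
(* 0..m-1, coordinates 0..d-1.  A point of R^d is a function nat -> R   *)
(* of which only coordinates < d matter.                                *)

Fixpoint sumR (N : nat) (g : nat -> R) : R :=
  match N with O => 0 | S N' => sumR N' g + g N' end.

Fixpoint countN (N : nat) (p : nat -> bool) : nat :=
  match N with O => O | S N' => (countN N' p + (if p N' then 1 else 0))%nat end.

Definition sqdist (d : nat) (x y : nat -> R) : R :=
  sumR d (fun k => (x k - y k) ^ 2).
Definition dist2 (d : nat) (x y : nat -> R) : R := sqrt (sqdist d x y).

(* Tie-breaking priority between two distinct candidates k, j:
   [prio constructive k j] = k is placed ahead of j when equidistant.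
   Constructive: c_1 (index 0) goes ahead of equidistant candidates;
   destructive: c_1 goes behind.  Ties among the other candidates never
   occur (the others do not move and original rankings have no ties);
   they are broken by index for definiteness. *)
Definition prio (constructive : bool) (k j : nat) : bool :=
  if constructive
  then (Nat.eqb k 0 || (negb (Nat.eqb j 0) && Nat.ltb k j))%bool
  else (negb (Nat.eqb k 0) && (Nat.eqb j 0 || Nat.ltb k j))%bool.

Definition rank (constructive : bool) (n d : nat) (Cp : nat -> nat -> R)
  (v : nat -> R) (j : nat) : nat :=
  S (countN n (fun k =>
       if Nat.eqb k j then false
       else if Rlt_dec (dist2 d v (Cp k)) (dist2 d v (Cp j)) then true
       else if Req_EM_T (dist2 d v (Cp k)) (dist2 d v (Cp j))
            then prio constructive k j else false)).

Definition score (constructive : bool) (n m d : nat) (f : nat -> R)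
  (Cp V : nat -> nat -> R) (j : nat) : R :=
  sumR m (fun i => f (rank constructive n d Cp (V i) j)).

Definition moved (C : nat -> nat -> R) (ct : nat -> R) : nat -> nat -> R :=
  fun j => if Nat.eqb j 0 then ct else C j.

Definition constructive_possible (n m d : nat) (eps : R) (f : nat -> R)
  (C V : nat -> nat -> R) : Prop :=
  exists ct : nat -> R, dist2 d ct (C 0%nat) <= eps /\
    forall j, (j < n)%nat ->
      score true n m d f (moved C ct) V j <= score true n m d f (moved C ct) V 0.

Definition destructive_possible (n m d : nat) (eps : R) (f : nat -> R)
  (C V : nat -> nat -> R) : Prop :=
  exists ct : nat -> R, dist2 d ct (C 0%nat) <= eps /\
    exists j, (0 < j < n)%nat /\
      score false n m d f (moved C ct) V 0 <= score false n m d f (moved C ct) V j.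

Definition valid_instance (n m d : nat) (eps : R) (f : nat -> R)
  (C V : nat -> nat -> R) : Prop :=
  (1 <= n)%nat /\ 0 < eps /\
  (forall t t', (1 <= t)%nat -> (t <= t')%nat -> (t' <= n)%nat -> f t' <= f t) /\
  (forall i j k, (i < m)%nat -> (j < n)%nat -> (k < n)%nat -> j <> k ->
     dist2 d (V i) (C j) <> dist2 d (V i) (C k)).

(* Part 2: the machine model -- a unit-cost real RAM (BSS-style).     *)

Inductive instr : Type :=
| RConst (dst : nat) (z : Z)
| RAdd (dst a b : nat)
| RSub (dst a b : nat)
| RMul (dst a b : nat)
| RDiv (dst a b : nat)
| RSqrt (dst a : nat)
| RLoad (dst ia : nat)
| RStore (ia src : nat)
| NConst (dst c : nat)
| NAdd (dst a b : nat)
| NSub (dst a b : nat)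
| JRLt (a b tgt : nat)
| JREq (a b tgt : nat)
| JNLt (a b tgt : nat)
| Jmp (tgt : nat)
| Halt (answer : bool).

Definition program := list instr.

Record config := Config { pc : nat; rmem : nat -> R; nmem : nat -> nat }.

Inductive result := Cont (c : config) | Done (b : bool) | Stuck.

Definition updR (r : nat -> R) (a : nat) (x : R) : nat -> R :=
  fun k => if Nat.eqb k a then x else r k.
Definition updN (r : nat -> nat) (a : nat) (x : nat) : nat -> nat :=
  fun k => if Nat.eqb k a then x else r k.

Definition step (P : program) (c : config) : result :=
  let r := rmem c in let ix := nmem c in let p := pc c in
  let nxt r' ix' := Cont (Config (S p) r' ix') in
  match nth_error P p with
  | None => Stuck
  | Some ins =>
    match ins with
    | RConst dst z => nxt (updR r dst (IZR z)) ix
    | RAdd dst a b => nxt (updR r dst (r a + r b)) ix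
    | RSub dst a b => nxt (updR r dst (r a - r b)) ix
    | RMul dst a b => nxt (updR r dst (r a * r b)) ix
    | RDiv dst a b =>
        if Req_EM_T (r b) 0 then Stuck else nxt (updR r dst (r a / r b)) ix
    | RSqrt dst a =>
        if Rlt_dec (r a) 0 then Stuck else nxt (updR r dst (sqrt (r a))) ix
    | RLoad dst ia => nxt (updR r dst (r (ix ia))) ix
    | RStore ia src => nxt (updR r (ix ia) (r src)) ix
    | NConst dst k => nxt r (updN ix dst k)
    | NAdd dst a b => nxt r (updN ix dst (ix a + ix b)%nat)
    | NSub dst a b => nxt r (updN ix dst (ix a - ix b)%nat)
    | JRLt a b tgt =>
        if Rlt_dec (r a) (r b) then Cont (Config tgt r ix) else nxt r ix
    | JREq a b tgt =>
        if Req_EM_T (r a) (r b) then Cont (Config tgt r ix) else nxt r ix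
    | JNLt a b tgt =>
        if Nat.ltb (ix a) (ix b) then Cont (Config tgt r ix) else nxt r ix
    | Jmp tgt => Cont (Config tgt r ix)
    | Halt b => Done b
    end
  end.

Fixpoint run (P : program) (fuel : nat) (c : config) : option bool :=
  match fuel with
  | O => None
  | S f' => match step P c with
            | Cont c' => run P f' c'
            | Done b => Some b
            | Stuck => None
            end
  end.

(* Input encoding: index registers ix[0]=n, ix[1]=m, ix[2]=d;
   real registers r[0]=eps, r[t]=f(t) for 1<=t<=n,
   r[1+n+j*d+k] = k-th coordinate of candidate j (j<n, k<d),
   r[1+n+n*d+i*d+k] = k-th coordinate of voter i (i<m, k<d);
   all other registers are 0.  Execution starts at pc = 0. *)
Definition init_rmem (n m d : nat) (eps : R) (f : nat -> R)
  (C V : nat -> nat -> R) : nat -> R :=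
  fun a =>
    if Nat.eqb a 0 then eps
    else if Nat.leb a n then f a
    else if Nat.ltb a (1 + n + n * d) then
      C ((a - 1 - n) / d)%nat ((a - 1 - n) mod d)%nat
    else if Nat.ltb a (1 + n + n * d + m * d) then
      V ((a - 1 - n - n * d) / d)%nat ((a - 1 - n - n * d) mod d)%nat
    else 0.

Definition init_nmem (n m d : nat) : nat -> nat :=
  fun a => match a with 0 => n | 1 => m | 2 => d | _ => 0 end%nat.

Definition init_config (n m d : nat) (eps : R) (f : nat -> R)
  (C V : nat -> nat -> R) : config :=
  Config 0 (init_rmem n m d eps f C V) (init_nmem n m d).

(* number of input values (plus 2, so that it is >= 2) *)
Definition input_size (n m d : nat) : nat := (n + (n + m) * d + 2)%nat.

Definition poly_decides_fixed_m (m : nat)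
  (Q : nat -> nat -> nat -> R -> (nat -> R) -> (nat -> nat -> R) ->
       (nat -> nat -> R) -> Prop) : Prop :=
  exists (P : program) (c k : nat),
    forall n d eps f C V,
      valid_instance n m d eps f C V ->
      exists b : bool,
        run P (c * input_size n m d ^ k)%nat (init_config n m d eps f C V) = Some b
        /\ (b = true <-> Q n m d eps f C V).

(* Main.v *)
(* Moving the target closer to (resp. away from) a voter only helps the
   adversary, so only the distances of the other candidates to that voter matter
   as thresholds: there are at most n^m vectors of thresholds, and for each of
   them one compares the scores and asks whether a point of the ball of radius
   epsilon lies within (resp. beyond) the thresholds.  By an isometry, the latter
   question depends only on the Gram matrix of the m vectors v_i - c_1 and can be
   asked in dimension min(d, m + 1).  It is thus a first-order formula of fixed
   size, which quantifier elimination over the reals turns into a fixed Boolean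
   combination of polynomial inequalities with rational coefficients.  The whole
   test is an expression with sums of n or d terms, compiled to the machine. *)

Require Import Defs.
From Stdlib Require Import Reals Lra Lia List Arith ZArith Bool.
From Stdlib Require Import FunctionalExtensionality.
Import ListNotations.
Local Open Scope R_scope.

(** * Structured commands for the machine *)

(** The program must be chosen before [n], [d] and the real data are known, and its constants are
    integers. Several obstacles follow. The elimination procedure works over the field [R] itself,
    so its output might contain arbitrary real constants; each of its stages is shown to keep
    constants rational, the delicate case being the inverse of an integer matrix. The input fills
    the low real registers up to a length that varies with the instance, so no fixed register is
    free; the input is therefore copied beyond a work area of fixed size. Running time is controlled
    by syntax: the loops of an expression run up to [n] or [d] only, so the degree of the cost is
    the nesting depth of its sums. Square roots are avoided by comparing squared distances. A voter
    may also impose no constraint at all; this is encoded by the threshold of index 0, the index of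
    the target itself. Finally, a formula has a fixed number of quantified coordinates, so there is
    one formula for each dimension from 0 to [m + 1], and the machine selects among them at run
    time. *)

Definition state : Type := ((nat -> R) * (nat -> nat))%type.

(** [None] covers division by zero, where the machine is stuck, together with jumps and halts, which
    are emitted separately, and [RSqrt], since distances are compared through their squares. *)
Definition prim_exec (i : instr) (s : state) : option state :=
  let (r, ix) := s in
  match i with
  | RConst dst z => Some (updR r dst (IZR z), ix)
  | RAdd dst a b => Some (updR r dst (r a + r b), ix)
  | RSub dst a b => Some (updR r dst (r a - r b), ix)
  | RMul dst a b => Some (updR r dst (r a * r b), ix)
  | RDiv dst a b =>
      if Req_EM_T (r b) 0 then None else Some (updR r dst (r a / r b), ix)
  | RLoad dst ia => Some (updR r dst (r (ix ia)), ix)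
  | RStore ia src => Some (updR r (ix ia) (r src), ix)
  | NConst dst k => Some (r, updN ix dst k)
  | NAdd dst a b => Some (r, updN ix dst (ix a + ix b)%nat)
  | NSub dst a b => Some (r, updN ix dst (ix a - ix b)%nat)
  | _ => None
  end.

Inductive cmd :=
| Prim (i : instr)
| Seq (c1 c2 : cmd)
| IfRLt (a b : nat) (c1 c2 : cmd)
| IfNLt (a b : nat) (c1 c2 : cmd)
| WhileLt (a b : nat) (c : cmd).

(** The last argument is the exact number of machine steps of the compiled code. A false test costs
    one step more than a true one, for the jump over the true branch; each turn of a loop pays for
    the test and the jump back, and leaving it for the test and the jump out. *)
Inductive exec : cmd -> state -> state -> nat -> Prop :=
| EPrim i s s' : prim_exec i s = Some s' -> exec (Prim i) s s' 1
| ESeq c1 c2 s s1 s2 t1 t2 :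
    exec c1 s s1 t1 -> exec c2 s1 s2 t2 -> exec (Seq c1 c2) s s2 (t1 + t2)
| EIfRT a b c1 c2 s s' t :
    fst s a < fst s b -> exec c1 s s' t -> exec (IfRLt a b c1 c2) s s' (S t)
| EIfRF a b c1 c2 s s' t :
    ~ fst s a < fst s b -> exec c2 s s' t -> exec (IfRLt a b c1 c2) s s' (S (S t))
| EIfNT a b c1 c2 s s' t :
    (snd s a < snd s b)%nat -> exec c1 s s' t -> exec (IfNLt a b c1 c2) s s' (S t)
| EIfNF a b c1 c2 s s' t :
    ~ (snd s a < snd s b)%nat -> exec c2 s s' t ->
    exec (IfNLt a b c1 c2) s s' (S (S t))
| EWhileF a b c s :
    ~ (snd s a < snd s b)%nat -> exec (WhileLt a b c) s s 2
| EWhileT a b c s s1 s2 t1 t2 :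
    (snd s a < snd s b)%nat -> exec c s s1 t1 ->
    exec (WhileLt a b c) s1 s2 t2 -> exec (WhileLt a b c) s s2 (S (S (t1 + t2))).

Fixpoint code_size (c : cmd) : nat :=
  match c with
  | Prim _ => 1
  | Seq c1 c2 => code_size c1 + code_size c2
  | IfRLt _ _ c1 c2 | IfNLt _ _ c1 c2 => 2 + code_size c2 + code_size c1
  | WhileLt _ _ c => 3 + code_size c
  end.

(** Jump targets are absolute, hence the address [p]. The false branch stands first, because the
    machine jumps when a test succeeds and falls through otherwise. *)
Fixpoint code (p : nat) (c : cmd) : program :=
  match c with
  | Prim i => [i]
  | Seq c1 c2 => code p c1 ++ code (p + code_size c1) c2
  | IfRLt a b c1 c2 =>
      JRLt a b (2 + p + code_size c2) :: code (S p) c2 ++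
      Jmp (2 + p + code_size c2 + code_size c1) :: code (2 + p + code_size c2) c1
  | IfNLt a b c1 c2 =>
      JNLt a b (2 + p + code_size c2) :: code (S p) c2 ++
      Jmp (2 + p + code_size c2 + code_size c1) :: code (2 + p + code_size c2) c1
  | WhileLt a b c =>
      JNLt a b (2 + p) :: Jmp (3 + p + code_size c) :: code (2 + p) c ++ [Jmp p]
  end.

Lemma code_length c : forall p, length (code p c) = code_size c.
Proof.
  induction c; intros p; simpl; auto.
  - rewrite length_app, IHc1, IHc2; auto.
  - rewrite length_app; simpl; rewrite IHc1, IHc2; lia.
  - rewrite length_app; simpl; rewrite IHc1, IHc2; lia.
  - rewrite length_app; simpl; rewrite IHc; lia.
Qed.

Definition code_at (P : program) (p : nat) (l : program) : Prop :=
  forall k, (k < length l)%nat -> nth_error P (p + k) = nth_error l k.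

Lemma code_at_app P p l1 l2 :
  code_at P p (l1 ++ l2) -> code_at P p l1 /\ code_at P (p + length l1) l2.
Proof.
  intros H; split; intros k Hk.
  - rewrite H by (rewrite length_app; lia). apply nth_error_app1; lia.
  - rewrite <- Nat.add_assoc, H by (rewrite length_app; lia).
    rewrite nth_error_app2 by lia. f_equal; lia.
Qed.

Lemma code_at_cons P p i l :
  code_at P p (i :: l) -> nth_error P p = Some i /\ code_at P (S p) l.
Proof.
  intros H; split.
  - specialize (H 0%nat); simpl in H; rewrite Nat.add_0_r in H; apply H; lia.
  - intros k Hk. specialize (H (S k)); simpl in H.
    rewrite <- H by lia. f_equal; lia.
Qed.

Definition conf (p : nat) (s : state) : config := Config p (fst s) (snd s).

Lemma step_prim P p i s s' :
  nth_error P p = Some i -> prim_exec i s = Some s' ->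
  step P (conf p s) = Cont (conf (S p) s').
Proof.
  destruct s as [r ix]; intros Hi H; unfold step, conf; simpl; rewrite Hi.
  destruct i; simpl in H; try discriminate; try (injection H as <-; reflexivity).
  destruct (Req_EM_T (r b) 0); [discriminate | injection H as <-; reflexivity].
Qed.

Lemma step_jmp P p tgt s :
  nth_error P p = Some (Jmp tgt) -> step P (conf p s) = Cont (conf tgt s).
Proof. intros H; unfold step; simpl; rewrite H; reflexivity. Qed.

Lemma step_jnlt P p a b tgt s :
  nth_error P p = Some (JNLt a b tgt) ->
  step P (conf p s) = Cont (conf (if Nat.ltb (snd s a) (snd s b) then tgt else S p) s).
Proof.
  intros H; unfold step; simpl; rewrite H. destruct (Nat.ltb _ _); reflexivity.
Qed.

Lemma step_jrlt P p a b tgt s :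
  nth_error P p = Some (JRLt a b tgt) ->
  step P (conf p s) =
  Cont (conf (if Rlt_dec (fst s a) (fst s b) then tgt else S p) s).
Proof.
  intros H; unfold step; simpl; rewrite H. destruct (Rlt_dec _ _); reflexivity.
Qed.

Lemma run_step P c c' fuel :
  step P c = Cont c' -> run P (S fuel) c = run P fuel c'.
Proof. intros H; simpl; rewrite H; reflexivity. Qed.

(** Quantifying over the remaining fuel makes the statement compose: each derivation consumes
    exactly its own count [t]. *)
Lemma exec_run c s s' t :
  exec c s s' t -> forall P p, code_at P p (code p c) ->
  forall fuel, run P (t + fuel) (conf p s) = run P fuel (conf (p + code_size c) s').
Proof.
  induction 1; intros P p HP fuel; simpl in HP; cbn [Nat.add code_size].
  - apply code_at_cons in HP as [HP _].
    rewrite (run_step _ _ _ _ (step_prim P p i s s' HP H)). f_equal. f_equal; lia.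
  - apply code_at_app in HP as [HP1 HP2]. rewrite code_length in HP2.
    rewrite <- Nat.add_assoc, (IHexec1 P p HP1), (IHexec2 P _ HP2).
    f_equal. f_equal; lia.
  - apply code_at_cons in HP as [HP HP'].
    apply code_at_app in HP' as [_ HP']. apply code_at_cons in HP' as [_ HP'].
    rewrite (run_step _ _ _ _ (step_jrlt _ _ _ _ _ _ HP)).
    destruct (Rlt_dec _ _); [|contradiction].
    rewrite code_length in HP'.
    replace (S (S p + code_size c2))%nat with (S (S (p + code_size c2)))%nat in HP' by lia.
    rewrite (IHexec P _ HP'). f_equal. f_equal; lia.
  - apply code_at_cons in HP as [HP HP'].
    apply code_at_app in HP' as [HP2 HP']. apply code_at_cons in HP' as [HP' _].
    rewrite (run_step _ _ _ _ (step_jrlt _ _ _ _ _ _ HP)).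
    destruct (Rlt_dec _ _); [contradiction|].
    replace (S (t + fuel)) with (t + S fuel)%nat by lia.
    rewrite (IHexec P _ HP2). rewrite code_length in HP'.
    rewrite (run_step _ _ _ _ (step_jmp _ _ _ _ HP')). f_equal. f_equal; lia.
  - apply code_at_cons in HP as [HP HP'].
    apply code_at_app in HP' as [_ HP']. apply code_at_cons in HP' as [_ HP'].
    rewrite (run_step _ _ _ _ (step_jnlt _ _ _ _ _ _ HP)), (proj2 (Nat.ltb_lt _ _) H).
    rewrite code_length in HP'.
    replace (S (S p + code_size c2))%nat with (S (S (p + code_size c2)))%nat in HP' by lia.
    rewrite (IHexec P _ HP'). f_equal. f_equal; lia.
  - apply code_at_cons in HP as [HP HP'].
    apply code_at_app in HP' as [HP2 HP']. apply code_at_cons in HP' as [HP' _].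
    rewrite (run_step _ _ _ _ (step_jnlt _ _ _ _ _ _ HP)), (proj2 (Nat.ltb_ge _ _)) by lia.
    replace (S (t + fuel)) with (t + S fuel)%nat by lia.
    rewrite (IHexec P _ HP2). rewrite code_length in HP'.
    rewrite (run_step _ _ _ _ (step_jmp _ _ _ _ HP')). f_equal. f_equal; lia.
  - apply code_at_cons in HP as [HP HP']. apply code_at_cons in HP' as [HP' _].
    rewrite (run_step _ _ _ _ (step_jnlt _ _ _ _ _ _ HP)), (proj2 (Nat.ltb_ge _ _)) by lia.
    rewrite (run_step _ _ _ _ (step_jmp _ _ _ _ HP')). f_equal. f_equal; lia.
  (* The last premise executes the same loop from the same address, so the code hypothesis of the
     whole loop is kept for its induction hypothesis. *)
  - pose proof HP as HP0.
    apply code_at_cons in HP as [HP HP']. apply code_at_cons in HP' as [_ HP'].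
    apply code_at_app in HP' as [HP2 HP']. apply code_at_cons in HP' as [HP' _].
    rewrite (run_step _ _ _ _ (step_jnlt _ _ _ _ _ _ HP)), (proj2 (Nat.ltb_lt _ _) H).
    replace (S (t1 + t2 + fuel)) with (t1 + S (t2 + fuel))%nat by lia.
    rewrite (IHexec1 P _ HP2). rewrite code_length in HP'.
    replace (S (S p) + code_size c)%nat with (2 + p + code_size c)%nat in HP' by lia.
    rewrite (run_step _ _ _ _ (step_jmp _ _ _ _ HP')).
    apply (IHexec2 P p HP0).
Qed.

(** * Expressions with bounded sums, and their compilation *)

(** Truth values are numbers, positive meaning true. [NSum] thus serves as a counter, as an
    existential quantifier over candidates and, with a constant body, as a product. Its range is [n]
    or [d] only, which keeps the cost polynomial. Real division occurs only in constants, so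
    evaluation never gets stuck. *)
Inductive nexp :=
| NC (c : nat)
| NVar (x : nat)
| NLim (dim : bool)
| NPlus (a b : nexp)
| NMinus (a b : nexp)
| NLt (a b : nexp)
| RLt (a b : rexp)
| NIf (c a b : nexp)
| NSum (x : nat) (dim : bool) (b : nexp)
with rexp :=
| RC (z : Z) (w : positive)
| RLd (a : nexp)
| RPlus (a b : rexp)
| RMinus (a b : rexp)
| RTimes (a b : rexp)
| RIf (c : nexp) (a b : rexp)
| RSum (x : nat) (dim : bool) (b : rexp).

Scheme nexp_rexp_ind := Induction for nexp Sort Prop
with rexp_nexp_ind := Induction for rexp Sort Prop.
Combined Scheme exp_ind from nexp_rexp_ind, rexp_nexp_ind.

(* Index registers 0, 1, 2 keep n, m, d; register 3 holds the offset of the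
   relocated input; program variables start at register 4. *)
Definition lim_reg (dim : bool) : nat := if dim then 2 else 0.
Definition off_reg : nat := 3.
Definition var_reg (x : nat) : nat := (4 + x)%nat.

Fixpoint sumN (N : nat) (g : nat -> nat) : nat :=
  match N with O => O | S N' => (sumN N' g + g N')%nat end.

Fixpoint denN (e : nexp) (ix : nat -> nat) (M : nat -> R) : nat :=
  match e with
  | NC c => c
  | NVar x => ix (var_reg x)
  | NLim b => ix (lim_reg b)
  | NPlus a b => denN a ix M + denN b ix M
  | NMinus a b => denN a ix M - denN b ix M
  | NLt a b => if Nat.ltb (denN a ix M) (denN b ix M) then 1 else 0
  | RLt a b => if Rlt_dec (denR a ix M) (denR b ix M) then 1 else 0
  | NIf c a b => if Nat.ltb 0 (denN c ix M) then denN a ix M else denN b ix M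
  | NSum x l b => sumN (ix (lim_reg l)) (fun k => denN b (updN ix (var_reg x) k) M)
  end%nat
with denR (e : rexp) (ix : nat -> nat) (M : nat -> R) : R :=
  match e with
  | RC z w => IZR z / IZR (Zpos w)
  | RLd a => M (denN a ix M)
  | RPlus a b => denR a ix M + denR b ix M
  | RMinus a b => denR a ix M - denR b ix M
  | RTimes a b => denR a ix M * denR b ix M
  | RIf c a b => if Nat.ltb 0 (denN c ix M) then denR a ix M else denR b ix M
  | RSum x l b => sumR (ix (lim_reg l)) (fun k => denR b (updN ix (var_reg x) k) M)
  end.

Notation "c1 ;; c2" := (Seq c1 c2) (at level 60, right associativity).

Definition move_reg (dst src : nat) : cmd := Prim (NConst dst 0) ;; Prim (NAdd dst dst src).

(* [l] and [q] are the first free index and real registers; the result of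
   [compN e l q] is left in index register [l], that of [compR e l q] in real
   register [q]. *)
Fixpoint compN (e : nexp) (l q : nat) : cmd :=
  match e with
  | NC c => Prim (NConst l c)
  | NVar x => move_reg l (var_reg x)
  | NLim b => move_reg l (lim_reg b)
  | NPlus a b => compN a l q ;; compN b (S l) q ;; Prim (NAdd l l (S l))
  | NMinus a b => compN a l q ;; compN b (S l) q ;; Prim (NSub l l (S l))
  | NLt a b => compN a l q ;; compN b (S l) q ;;
      IfNLt l (S l) (Prim (NConst l 1)) (Prim (NConst l 0))
  | RLt a b => compR a l q ;; compR b l (S q) ;;
      IfRLt q (S q) (Prim (NConst l 1)) (Prim (NConst l 0))
  | NIf c a b => compN c l q ;; Prim (NConst (S l) 0) ;;
      IfNLt (S l) l (compN a l q) (compN b l q)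
  | NSum x lim b =>
      Prim (NConst l 0) ;; move_reg (S l) (var_reg x) ;;
      Prim (NConst (var_reg x) 0) ;;
      WhileLt (var_reg x) (lim_reg lim)
        (compN b (S (S l)) q ;; Prim (NAdd l l (S (S l))) ;;
         Prim (NConst (S (S l)) 1) ;;
         Prim (NAdd (var_reg x) (var_reg x) (S (S l)))) ;;
      move_reg (var_reg x) (S l)
  end
with compR (e : rexp) (l q : nat) : cmd :=
  match e with
  | RC z w => Prim (RConst q z) ;; Prim (RConst (S q) (Zpos w)) ;;
      Prim (RDiv q q (S q))
  | RLd a => compN a l q ;; Prim (NAdd l l off_reg) ;; Prim (RLoad q l)
  | RPlus a b => compR a l q ;; compR b l (S q) ;; Prim (RAdd q q (S q))
  | RMinus a b => compR a l q ;; compR b l (S q) ;; Prim (RSub q q (S q))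
  | RTimes a b => compR a l q ;; compR b l (S q) ;; Prim (RMul q q (S q))
  | RIf c a b => compN c l q ;; Prim (NConst (S l) 0) ;;
      IfNLt (S l) l (compR a l q) (compR b l q)
  | RSum x lim b =>
      Prim (RConst q 0) ;; move_reg (S l) (var_reg x) ;;
      Prim (NConst (var_reg x) 0) ;;
      WhileLt (var_reg x) (lim_reg lim)
        (compR b (S (S l)) (S q) ;; Prim (RAdd q q (S q)) ;;
         Prim (NConst (S (S l)) 1) ;;
         Prim (NAdd (var_reg x) (var_reg x) (S (S l)))) ;;
      move_reg (var_reg x) (S l)
  end.

Fixpoint varsN (e : nexp) : nat :=
  match e with
  | NC _ | NLim _ => 0
  | NVar x => S x
  | NPlus a b | NMinus a b | NLt a b => Nat.max (varsN a) (varsN b)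
  | RLt a b => Nat.max (varsR a) (varsR b)
  | NIf c a b => Nat.max (varsN c) (Nat.max (varsN a) (varsN b))
  | NSum x _ b => Nat.max (S x) (varsN b)
  end%nat
with varsR (e : rexp) : nat :=
  match e with
  | RC _ _ => 0
  | RLd a => varsN a
  | RPlus a b | RMinus a b | RTimes a b => Nat.max (varsR a) (varsR b)
  | RIf c a b => Nat.max (varsN c) (Nat.max (varsR a) (varsR b))
  | RSum x _ b => Nat.max (S x) (varsR b)
  end%nat.

(** A bound on the number of real registers that the compiled code uses from [q] on. It is fixed by
    the syntax, so the end of the work area is known before the input is seen. *)
Fixpoint rdepthN (e : nexp) : nat :=
  match e with
  | NC _ | NLim _ | NVar _ => 0
  | NPlus a b | NMinus a b | NLt a b => Nat.max (rdepthN a) (rdepthN b)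
  | RLt a b => S (Nat.max (rdepthR a) (rdepthR b))
  | NIf c a b => Nat.max (rdepthN c) (Nat.max (rdepthN a) (rdepthN b))
  | NSum _ _ b => rdepthN b
  end%nat
with rdepthR (e : rexp) : nat :=
  match e with
  | RC _ _ => 2
  | RLd a => S (rdepthN a)
  | RPlus a b | RMinus a b | RTimes a b => S (Nat.max (rdepthR a) (rdepthR b))
  | RIf c a b => Nat.max (rdepthN c) (Nat.max (rdepthR a) (rdepthR b))
  | RSum _ _ b => S (rdepthR b)
  end%nat.

(** [N] bounds both [n] and [d]. In a sum, 5 pays for the test, the accumulation, the increment and
    the jump back of one turn; 8 pays for the setup, the exit and the restoration of the
    variable. *)
Fixpoint costN (e : nexp) (N : nat) : nat :=
  match e with
  | NC _ | NLim _ | NVar _ => 2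
  | NPlus a b | NMinus a b | NLt a b => costN a N + costN b N + 3
  | RLt a b => costR a N + costR b N + 3
  | NIf c a b => costN c N + costN a N + costN b N + 3
  | NSum _ _ b => N * (costN b N + 5) + 8
  end%nat
with costR (e : rexp) (N : nat) : nat :=
  match e with
  | RC _ _ => 3
  | RLd a => costN a N + 2
  | RPlus a b | RMinus a b | RTimes a b => costR a N + costR b N + 1
  | RIf c a b => costN c N + costR a N + costR b N + 3
  | RSum _ _ b => N * (costR b N + 5) + 8
  end%nat.

(** * Polynomial bounds on the cost *)

Definition poly_bounded (f : nat -> nat) : Prop :=
  exists c k, forall N, (1 <= N)%nat -> (f N <= c * N ^ k)%nat.

Lemma poly_bounded_const c : poly_bounded (fun _ => c).
Proof. exists c, 0%nat; intros; simpl; lia. Qed.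

Lemma poly_bounded_id : poly_bounded (fun N => N).
Proof. exists 1%nat, 1%nat; intros; simpl; lia. Qed.

Lemma poly_bounded_add f g :
  poly_bounded f -> poly_bounded g -> poly_bounded (fun N => f N + g N)%nat.
Proof.
  intros (c & k & Hf) (c' & k' & Hg). exists (c + c')%nat, (k + k')%nat.
  intros N HN. specialize (Hf N HN). specialize (Hg N HN).
  rewrite Nat.pow_add_r.
  assert (1 <= N ^ k /\ 1 <= N ^ k')%nat.
  { split; rewrite <- (Nat.pow_1_l 0); apply Nat.neq_0_lt_0, Nat.pow_nonzero; lia. }
  nia.
Qed.

Lemma poly_bounded_mul f g :
  poly_bounded f -> poly_bounded g -> poly_bounded (fun N => f N * g N)%nat.
Proof.
  intros (c & k & Hf) (c' & k' & Hg). exists (c * c')%nat, (k + k')%nat.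
  intros N HN. rewrite Nat.pow_add_r.
  replace (c * c' * (N ^ k * N ^ k'))%nat with ((c * N ^ k) * (c' * N ^ k'))%nat by lia.
  apply Nat.mul_le_mono; auto.
Qed.

(** By structural induction: a sum multiplies the cost by [N], and everything else adds costs. *)
Lemma cost_poly_bounded :
  (forall e, poly_bounded (costN e)) /\ (forall e, poly_bounded (costR e)).
Proof.
  apply exp_ind; intros; simpl;
    repeat first [ assumption | apply poly_bounded_add | apply poly_bounded_mul
                 | apply poly_bounded_const | apply poly_bounded_id ].
Qed.

Lemma sumN_ext N g h : (forall k, (k < N)%nat -> g k = h k) -> sumN N g = sumN N h.
Proof. induction N; simpl; intros H; auto. rewrite IHN, H; auto. Qed.

Lemma sumR_ext N g h : (forall k, (k < N)%nat -> g k = h k) -> sumR N g = sumR N h.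
Proof. induction N; simpl; intros H; auto. rewrite IHN, H; auto. Qed.

Lemma updN_same ix a x : updN ix a x a = x.
Proof. unfold updN; rewrite Nat.eqb_refl; reflexivity. Qed.

Lemma updN_diff ix a x k : k <> a -> updN ix a x k = ix k.
Proof. intros H; unfold updN; apply Nat.eqb_neq in H; rewrite H; reflexivity. Qed.

Lemma updR_same r a x : updR r a x a = x.
Proof. unfold updR; rewrite Nat.eqb_refl; reflexivity. Qed.

Lemma updR_diff r a x k : k <> a -> updR r a x k = r k.
Proof. intros H; unfold updR; apply Nat.eqb_neq in H; rewrite H; reflexivity. Qed.

Lemma lim_reg_lt b : (lim_reg b < 3)%nat.
Proof. destruct b; simpl; lia. Qed.

(** Scratch registers are allocated above the variables of an expression, so by this lemma their
    contents cannot influence its value. *)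
Lemma den_ext :
  (forall e ix ix' M M',
    (forall k, (k < var_reg (varsN e))%nat -> ix k = ix' k) ->
    (forall a, M a = M' a) -> denN e ix M = denN e ix' M') /\
  (forall e ix ix' M M',
    (forall k, (k < var_reg (varsR e))%nat -> ix k = ix' k) ->
    (forall a, M a = M' a) -> denR e ix M = denR e ix' M').
Proof.
  unfold var_reg; apply exp_ind; intros;
    match goal with
    | HM : forall a, ?M a = ?M' a, Hix : forall k, _ -> ?ix k = ?ix' k |- _ =>
        cbn [varsN varsR denN denR] in *;
        repeat match goal with
        | IH : forall _ _ _ _, _ -> _ -> _ |- _ =>
            rewrite (IH ix ix' M M') by (auto; intros; apply Hix; lia)
        end;
        try rewrite (Hix (lim_reg _)) by (pose proof (lim_reg_lt dim); lia);
        auto;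
        try first [apply sumN_ext | apply sumR_ext];
        intros;
        match goal with
        | IH : forall _ _ _ _, _ -> _ -> _ |- _ =>
            apply IH; auto; intros; unfold updN;
            destruct (Nat.eqb _ _); auto; apply Hix; lia
        | |- _ => apply Hix; unfold var_reg; lia
        end
    end.
Qed.

(** * Correctness of the compilation *)

Definition input_view (s : state) : nat -> R :=
  fun a => fst s (snd s off_reg + a)%nat.

(** Code compiled at [l] and [q] may touch only index registers from [l] on and real registers from
    [q] to below [K]; the relocated input lies beyond. *)
Definition framed (l q K : nat) (s s' : state) : Prop :=
  (forall k, (k < l)%nat -> snd s' k = snd s k) /\
  (forall a, (a < q \/ K <= a)%nat -> fst s' a = fst s a).

Definition ready (K N : nat) (s : state) : Prop :=
  (K <= snd s off_reg)%nat /\ forall b, (snd s (lim_reg b) <= N)%nat.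

Lemma framed_trans l q K l' q' s1 s2 s3 :
  (l <= l')%nat -> (q <= q')%nat ->
  framed l q K s1 s2 -> framed l' q' K s2 s3 -> framed l q K s1 s3.
Proof.
  intros Hl Hq [H1 H2] [H3 H4]; split.
  - intros k Hk. rewrite H3 by lia; auto.
  - intros a Ha. rewrite H4 by lia; auto.
Qed.

Lemma framed_ready l q K N s s' :
  (4 <= l)%nat -> framed l q K s s' -> ready K N s -> ready K N s'.
Proof.
  intros Hl [H1 _] [H2 H3]; split.
  - rewrite H1; unfold off_reg in *; lia.
  - intros b; rewrite H1; [apply H3|]. pose proof (lim_reg_lt b); lia.
Qed.

Lemma framed_view l q K N s s' :
  (4 <= l)%nat -> framed l q K s s' -> ready K N s ->
  forall a, input_view s' a = input_view s a.
Proof.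
  intros Hl [H1 H2] [H3 _] a. unfold input_view.
  rewrite H1 by (unfold off_reg; lia). apply H2; lia.
Qed.

Definition computesN (e : nexp) : Prop :=
  forall l q K N s, (var_reg (varsN e) <= l)%nat -> (q + rdepthN e <= K)%nat ->
  ready K N s ->
  exists s' t, exec (compN e l q) s s' t /\ (t <= costN e N)%nat /\
    snd s' l = denN e (snd s) (input_view s) /\ framed l q K s s'.

Definition computesR (e : rexp) : Prop :=
  forall l q K N s, (var_reg (varsR e) <= l)%nat -> (q + rdepthR e <= K)%nat ->
  ready K N s ->
  exists s' t, exec (compR e l q) s s' t /\ (t <= costR e N)%nat /\
    fst s' q = denR e (snd s) (input_view s) /\ framed l q K s s'.

Lemma exec_move dst src s :
  dst <> src ->
  exec (move_reg dst src) s (fst s, updN (updN (snd s) dst 0) dst (snd s src)) 2.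
Proof.
  intros H. destruct s as [r ix].
  apply (ESeq _ _ _ (r, updN ix dst 0) _ 1 1); apply EPrim; simpl; auto.
  rewrite updN_same, updN_diff by auto. reflexivity.
Qed.

Lemma framed_updN l q K s k x :
  (l <= k)%nat -> framed l q K s (fst s, updN (snd s) k x).
Proof. intros H; split; simpl; auto. intros; apply updN_diff; lia. Qed.

Lemma framed_updR l q K s a x :
  (q <= a < K)%nat -> framed l q K s (updR (fst s) a x, snd s).
Proof. intros H; split; simpl; auto. intros; apply updR_diff; lia. Qed.

Lemma denN_framed e l q K N s s' :
  (var_reg (varsN e) <= l)%nat -> framed l q K s s' -> ready K N s ->
  denN e (snd s') (input_view s') = denN e (snd s) (input_view s).
Proof.
  intros Hl Hf Hr. apply den_ext.
  - intros k Hk. apply Hf; lia.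
  - apply (framed_view l q K N); auto. unfold var_reg in Hl; lia.
Qed.

Lemma denR_framed e l q K N s s' :
  (var_reg (varsR e) <= l)%nat -> framed l q K s s' -> ready K N s ->
  denR e (snd s') (input_view s') = denR e (snd s) (input_view s).
Proof.
  intros Hl Hf Hr. apply den_ext.
  - intros k Hk. apply Hf; lia.
  - apply (framed_view l q K N); auto. unfold var_reg in Hl; lia.
Qed.

(** The second operand is compiled one register higher, so the first result survives in [l]; the
    variables are untouched, so the second value is still the one of the initial state. *)
Lemma pair_N a b l q K N s :
  computesN a -> computesN b ->
  (var_reg (Nat.max (varsN a) (varsN b)) <= l)%nat ->
  (q + Nat.max (rdepthN a) (rdepthN b) <= K)%nat -> ready K N s ->
  exists s1 s2 t1 t2,
    exec (compN a l q) s s1 t1 /\ exec (compN b (S l) q) s1 s2 t2 /\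
    (t1 + t2 <= costN a N + costN b N)%nat /\
    snd s2 l = denN a (snd s) (input_view s) /\
    snd s2 (S l) = denN b (snd s) (input_view s) /\ framed l q K s s2.
Proof.
  unfold var_reg; intros Ha Hb Hl Hq Hr.
  destruct (Ha l q K N s) as (s1 & t1 & E1 & T1 & D1 & F1); auto;
    try (unfold var_reg; lia).
  assert (Hr1 : ready K N s1) by (apply (framed_ready l q K N s); auto; lia).
  destruct (Hb (S l) q K N s1) as (s2 & t2 & E2 & T2 & D2 & F2); auto;
    try (unfold var_reg; lia).
  exists s1, s2, t1, t2. repeat split; auto; try lia.
  - rewrite <- D1. apply F2; lia.
  - rewrite D2. apply (denN_framed b l q K N); auto; unfold var_reg; lia.
  - apply (framed_trans l q K (S l) q s s1 s2); auto; lia.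
  - apply (framed_trans l q K (S l) q s s1 s2); auto; lia.
Qed.

Lemma pair_R a b l q K N s :
  computesR a -> computesR b ->
  (var_reg (Nat.max (varsR a) (varsR b)) <= l)%nat ->
  (q + S (Nat.max (rdepthR a) (rdepthR b)) <= K)%nat -> ready K N s ->
  exists s1 s2 t1 t2,
    exec (compR a l q) s s1 t1 /\ exec (compR b l (S q)) s1 s2 t2 /\
    (t1 + t2 <= costR a N + costR b N)%nat /\
    fst s2 q = denR a (snd s) (input_view s) /\
    fst s2 (S q) = denR b (snd s) (input_view s) /\ framed l q K s s2.
Proof.
  unfold var_reg; intros Ha Hb Hl Hq Hr.
  destruct (Ha l q K N s) as (s1 & t1 & E1 & T1 & D1 & F1); auto;
    try (unfold var_reg; lia).
  assert (Hr1 : ready K N s1) by (apply (framed_ready l q K N s); auto; lia).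
  destruct (Hb l (S q) K N s1) as (s2 & t2 & E2 & T2 & D2 & F2); auto;
    try (unfold var_reg; lia).
  exists s1, s2, t1, t2. repeat split; auto; try lia.
  - rewrite <- D1. apply F2; lia.
  - rewrite D2. apply (denR_framed b l q K N); auto; unfold var_reg; lia.
  - apply (framed_trans l q K l (S q) s s1 s2); auto; lia.
  - apply (framed_trans l q K l (S q) s s1 s2); auto; lia.
Qed.

Lemma framed_thenN l q K s s' k x :
  (l <= k)%nat -> framed l q K s s' -> framed l q K s (fst s', updN (snd s') k x).
Proof.
  intros H F. apply (framed_trans l q K l q s s'); auto. apply framed_updN; auto.
Qed.

Lemma framed_thenR l q K s s' a x :
  (q <= a < K)%nat -> framed l q K s s' -> framed l q K s (updR (fst s') a x, snd s').
Proof.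
  intros H F. apply (framed_trans l q K l q s s'); auto. apply framed_updR; auto.
Qed.

(** Invariant after [i] turns, relative to the state [s0] before the sum: register [l] holds the
    partial sum, and below [l] only the loop variable differs from [s0]. The body works from
    [S (S l)] on, which protects the accumulator and register [S l], where the former value of the
    loop variable is kept. *)
Lemma loop_N b x lim l q K N s0 :
  computesN b -> (var_reg (Nat.max (S x) (varsN b)) <= l)%nat ->
  (q + rdepthN b <= K)%nat -> ready K N s0 ->
  let g k := denN b (updN (snd s0) (var_reg x) k) (input_view s0) in
  let n := snd s0 (lim_reg lim) in
  forall rem i s, (i + rem = n)%nat ->
  (forall k, (k < l)%nat -> k <> var_reg x -> snd s k = snd s0 k) ->
  (forall a, (a < q \/ K <= a)%nat -> fst s a = fst s0 a) ->
  snd s (var_reg x) = i -> snd s l = sumN i g ->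
  exists s' t,
    exec (WhileLt (var_reg x) (lim_reg lim)
        (compN b (S (S l)) q ;; Prim (NAdd l l (S (S l))) ;;
         Prim (NConst (S (S l)) 1) ;;
         Prim (NAdd (var_reg x) (var_reg x) (S (S l))))) s s' t /\
    (t <= rem * (costN b N + 5) + 2)%nat /\
    (forall k, (k < l)%nat -> k <> var_reg x -> snd s' k = snd s0 k) /\
    (forall a, (a < q \/ K <= a)%nat -> fst s' a = fst s0 a) /\
    snd s' (S l) = snd s (S l) /\ snd s' l = sumN n g.
Proof.
  intros Hb Hl Hq Hr g n. pose proof (lim_reg_lt lim) as Hlim.
  unfold var_reg in Hl.
  assert (Hr' : forall s,
    (forall k, (k < l)%nat -> k <> var_reg x -> snd s k = snd s0 k) -> ready K N s).
  { intros s Hs. destruct Hr as [R1 R2]; split.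
    - rewrite Hs; auto; unfold off_reg, var_reg; lia.
    - intros c; pose proof (lim_reg_lt c); rewrite Hs; auto; unfold var_reg; lia. }
  induction rem as [|rem IH]; intros i s Hi Hs Hf Hx Hacc.
  - exists s, 2%nat. split; [|repeat split; auto].
    + apply EWhileF. rewrite Hx, (Hs (lim_reg lim)) by (unfold var_reg; lia).
      fold n; lia.
    + rewrite Hacc; f_equal; lia.
  - destruct (Hb (S (S l)) q K N s) as (s1 & t1 & E1 & T1 & D1 & F1); auto.
    { unfold var_reg; lia. }
    assert (D : snd s1 (S (S l)) = g i).
    { rewrite D1. unfold g. apply den_ext.
      - intros k Hk. unfold var_reg in Hk. destruct (Nat.eq_dec k (var_reg x)) as [->|Hn].
        + rewrite updN_same; auto.
        + rewrite updN_diff by auto. apply Hs; auto; lia.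
      - intros a. unfold input_view. rewrite Hs by (unfold off_reg, var_reg; lia).
        apply Hf. destruct Hr; lia. }
    set (ix2 := updN (snd s1) l (snd s1 l + snd s1 (S (S l)))%nat).
    set (ix3 := updN ix2 (S (S l)) 1).
    set (ix4 := updN ix3 (var_reg x) (ix3 (var_reg x) + ix3 (S (S l)))%nat).
    assert (Hxl : (var_reg x < l)%nat) by (unfold var_reg; lia).
    destruct F1 as [F1 F2].
    assert (X3 : ix3 (var_reg x) = i).
    { unfold ix3, ix2. rewrite !updN_diff by lia. rewrite F1 by lia. auto. }
    destruct (IH (S i) (fst s1, ix4)) as (s' & t & E & T & G1 & G2 & G3 & G4); simpl.
    + lia.
    + intros k Hk Hn. unfold ix4, ix3, ix2. rewrite !updN_diff by lia.
      rewrite F1 by lia; auto.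
    + intros a Ha. rewrite F2; auto.
    + unfold ix4. rewrite updN_same, X3. unfold ix3. rewrite updN_same; lia.
    + unfold ix4, ix3, ix2. rewrite updN_diff by lia. rewrite updN_diff by lia.
      rewrite updN_same, D, F1, Hacc by lia. reflexivity.
    + exists s', (S (S ((t1 + (1 + (1 + 1))) + t))).
      split; [|split; [|split; [|split; [|split]]]]; auto.
      * apply EWhileT with (fst s1, ix4).
        -- rewrite Hx, (Hs (lim_reg lim)) by (unfold var_reg; lia). fold n; lia.
        -- apply ESeq with s1; auto.
           apply ESeq with (fst s1, ix2); [apply EPrim; destruct s1; reflexivity|].
           apply ESeq with (fst s1, ix3); apply EPrim; reflexivity.
        -- apply E.
      * simpl in *; lia.
      * rewrite G3. simpl. unfold ix4, ix3, ix2. rewrite !updN_diff by lia.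
        apply F1; lia.
Qed.

(** Same invariant as in [loop_N], but the accumulator is the real register [q], so the body is
    compiled from [S q] on. *)
Lemma loop_R b x lim l q K N s0 :
  computesR b -> (var_reg (Nat.max (S x) (varsR b)) <= l)%nat ->
  (q + S (rdepthR b) <= K)%nat -> ready K N s0 ->
  let g k := denR b (updN (snd s0) (var_reg x) k) (input_view s0) in
  let n := snd s0 (lim_reg lim) in
  forall rem i s, (i + rem = n)%nat ->
  (forall k, (k < l)%nat -> k <> var_reg x -> snd s k = snd s0 k) ->
  (forall a, (a < q \/ K <= a)%nat -> fst s a = fst s0 a) ->
  snd s (var_reg x) = i -> fst s q = sumR i g ->
  exists s' t,
    exec (WhileLt (var_reg x) (lim_reg lim)
        (compR b (S (S l)) (S q) ;; Prim (RAdd q q (S q)) ;;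
         Prim (NConst (S (S l)) 1) ;;
         Prim (NAdd (var_reg x) (var_reg x) (S (S l))))) s s' t /\
    (t <= rem * (costR b N + 5) + 2)%nat /\
    (forall k, (k < l)%nat -> k <> var_reg x -> snd s' k = snd s0 k) /\
    (forall a, (a < q \/ K <= a)%nat -> fst s' a = fst s0 a) /\
    snd s' (S l) = snd s (S l) /\ fst s' q = sumR n g.
Proof.
  intros Hb Hl Hq Hr g n. pose proof (lim_reg_lt lim) as Hlim.
  unfold var_reg in Hl.
  assert (Hr' : forall s,
    (forall k, (k < l)%nat -> k <> var_reg x -> snd s k = snd s0 k) -> ready K N s).
  { intros s Hs. destruct Hr as [R1 R2]; split.
    - rewrite Hs; auto; unfold off_reg, var_reg; lia.
    - intros c; pose proof (lim_reg_lt c); rewrite Hs; auto; unfold var_reg; lia. }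
  induction rem as [|rem IH]; intros i s Hi Hs Hf Hx Hacc.
  - exists s, 2%nat. split; [|repeat split; auto].
    + apply EWhileF. rewrite Hx, (Hs (lim_reg lim)) by (unfold var_reg; lia).
      fold n; lia.
    + rewrite Hacc; f_equal; lia.
  - destruct (Hb (S (S l)) (S q) K N s) as (s1 & t1 & E1 & T1 & D1 & F1); auto;
      try (unfold var_reg; lia).
    assert (D : fst s1 (S q) = g i).
    { rewrite D1. unfold g. apply den_ext.
      - intros k Hk. unfold var_reg in Hk. destruct (Nat.eq_dec k (var_reg x)) as [->|Hn].
        + rewrite updN_same; auto.
        + rewrite updN_diff by auto. apply Hs; auto; lia.
      - intros a. unfold input_view. rewrite Hs by (unfold off_reg, var_reg; lia).
        apply Hf. destruct Hr; lia. }
    set (r2 := updR (fst s1) q (fst s1 q + fst s1 (S q))).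
    set (ix3 := updN (snd s1) (S (S l)) 1).
    set (ix4 := updN ix3 (var_reg x) (ix3 (var_reg x) + ix3 (S (S l)))%nat).
    assert (Hxl : (var_reg x < l)%nat) by (unfold var_reg; lia).
    destruct F1 as [F1 F2].
    assert (X3 : ix3 (var_reg x) = i).
    { unfold ix3. rewrite !updN_diff by lia. rewrite F1 by lia. auto. }
    destruct (IH (S i) (r2, ix4)) as (s' & t & E & T & G1 & G2 & G3 & G4); simpl.
    + lia.
    + intros k Hk Hn. unfold ix4, ix3. rewrite !updN_diff by lia.
      rewrite F1 by lia; auto.
    + intros a Ha. unfold r2. rewrite updR_diff by lia. rewrite F2 by lia; auto.
    + unfold ix4. rewrite updN_same, X3. unfold ix3. rewrite updN_same; lia.
    + unfold r2. rewrite updR_same, D, F2, Hacc by lia. reflexivity.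
    + exists s', (S (S ((t1 + (1 + (1 + 1))) + t))).
      split; [|split; [|split; [|split; [|split]]]]; auto.
      * apply EWhileT with (r2, ix4).
        -- rewrite Hx, (Hs (lim_reg lim)) by (unfold var_reg; lia). fold n; lia.
        -- apply ESeq with s1; auto.
           apply ESeq with (r2, snd s1); [apply EPrim; destruct s1; reflexivity|].
           apply ESeq with (r2, ix3); apply EPrim; reflexivity.
        -- apply E.
      * simpl in *; lia.
      * rewrite G3. simpl. unfold ix4, ix3. rewrite !updN_diff by lia.
        apply F1; lia.
Qed.

Lemma computes_sumN x lim b : computesN b -> computesN (NSum x lim b).
Proof.
  intros Hb l q K N s Hl Hq Hr. cbn [varsN rdepthN] in *.
  assert (Hxl : (var_reg x < l)%nat) by (unfold var_reg in *; lia).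
  pose proof (lim_reg_lt lim) as Hlim.
  set (ix1 := updN (snd s) l 0).
  set (ix2 := updN (updN ix1 (S l) 0) (S l) (ix1 (var_reg x))).
  set (ix3 := updN ix2 (var_reg x) 0).
  assert (Hix2 : forall k, (k < l)%nat -> ix2 k = snd s k).
  { intros k Hk. unfold ix2, ix1. rewrite !updN_diff by lia. reflexivity. }
  destruct (loop_N b x lim l q K N s Hb Hl Hq Hr (snd s (lim_reg lim)) 0 (fst s, ix3))
    as (s4 & t & E & T & G1 & G2 & G3 & G4); auto; simpl.
  - intros k Hk Hn. unfold ix3. rewrite updN_diff by auto. auto.
  - unfold ix3. apply updN_same.
  - unfold ix3, ix2, ix1. rewrite !updN_diff by lia. apply updN_same.
  - assert (HN : (snd s (lim_reg lim) <= N)%nat) by apply Hr.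
    (* The loop variable may be in use in the surrounding expression: its value was saved in [S l]
       and is put back, so that the frame condition holds below [l]. *)
    assert (Hsave : snd s4 (S l) = snd s (var_reg x)).
    { rewrite G3. simpl. unfold ix3. rewrite updN_diff by lia.
      unfold ix2. rewrite updN_same. unfold ix1. rewrite updN_diff by lia; auto. }
    set (ix5 := updN (updN (snd s4) (var_reg x) 0) (var_reg x) (snd s4 (S l))).
    exists (fst s4, ix5), (1 + (2 + (1 + (t + 2))))%nat.
    split; [|split; [|split; [|split]]];
      cbn [compN compR costN costR denN denR fst snd].
    + apply ESeq with (fst s, ix1); [apply EPrim; destruct s; reflexivity|].
      apply ESeq with (fst s, ix2).
      { apply (exec_move (S l) (var_reg x) (fst s, ix1)); lia. }
      apply ESeq with (fst s, ix3); [apply EPrim; reflexivity|].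
      apply ESeq with s4; [exact E|]. apply exec_move; lia.
    + pose proof (Nat.mul_le_mono_r _ _ (costN b N + 5) HN). lia.
    + unfold ix5. rewrite !updN_diff by lia. exact G4.
    + intros k Hk. unfold ix5. destruct (Nat.eq_dec k (var_reg x)) as [->|Hn].
      * rewrite updN_same; auto.
      * simpl. rewrite !updN_diff by lia. auto.
    + intros a Ha. simpl. auto.
Qed.

Lemma computes_sumR x lim b : computesR b -> computesR (RSum x lim b).
Proof.
  intros Hb l q K N s Hl Hq Hr. cbn [varsR rdepthR] in *.
  assert (Hxl : (var_reg x < l)%nat) by (unfold var_reg in *; lia).
  pose proof (lim_reg_lt lim) as Hlim.
  set (r1 := updR (fst s) q (IZR 0)).
  set (ix2 := updN (updN (snd s) (S l) 0) (S l) (snd s (var_reg x))).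
  set (ix3 := updN ix2 (var_reg x) 0).
  assert (Hix2 : forall k, (k < l)%nat -> ix2 k = snd s k).
  { intros k Hk. unfold ix2. rewrite !updN_diff by lia. reflexivity. }
  destruct (loop_R b x lim l q K N s Hb Hl Hq Hr (snd s (lim_reg lim)) 0 (r1, ix3))
    as (s4 & t & E & T & G1 & G2 & G3 & G4); auto; simpl.
  - intros k Hk Hn. unfold ix3. rewrite updN_diff by auto. auto.
  - intros a Ha. unfold r1. apply updR_diff. lia.
  - unfold ix3. apply updN_same.
  - unfold r1. apply updR_same.
  - assert (HN : (snd s (lim_reg lim) <= N)%nat) by apply Hr.
    assert (Hsave : snd s4 (S l) = snd s (var_reg x)).
    { rewrite G3. simpl. unfold ix3. rewrite updN_diff by lia.
      unfold ix2. rewrite updN_same. auto. }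
    set (ix5 := updN (updN (snd s4) (var_reg x) 0) (var_reg x) (snd s4 (S l))).
    exists (fst s4, ix5), (1 + (2 + (1 + (t + 2))))%nat.
    split; [|split; [|split; [|split]]];
      cbn [compN compR costN costR denN denR fst snd].
    + apply ESeq with (r1, snd s); [apply EPrim; destruct s; reflexivity|].
      apply ESeq with (r1, ix2).
      { apply (exec_move (S l) (var_reg x) (r1, snd s)); lia. }
      apply ESeq with (r1, ix3); [apply EPrim; reflexivity|].
      apply ESeq with s4; [exact E|]. apply exec_move; lia.
    + pose proof (Nat.mul_le_mono_r _ _ (costR b N + 5) HN). lia.
    + exact G4.
    + intros k Hk. unfold ix5. destruct (Nat.eq_dec k (var_reg x)) as [->|Hn].
      * rewrite updN_same; auto.
      * simpl. rewrite !updN_diff by lia. auto.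
    + intros a Ha. simpl. auto.
Qed.

Lemma computes_ifN c a b :
  computesN c -> computesN a -> computesN b -> computesN (NIf c a b).
Proof.
  intros Hc Ha Hb l q K N s Hl Hq Hr. cbn [varsN rdepthN] in *. unfold var_reg in Hl.
  destruct (Hc l q K N s) as (s1 & t1 & E1 & T1 & D1 & F1); auto;
    try (unfold var_reg; lia).
  set (s2 := (fst s1, updN (snd s1) (S l) 0)).
  assert (E2 : exec (Prim (NConst (S l) 0)) s1 s2 1)
    by (apply EPrim; destruct s1; reflexivity).
  assert (F2 : framed l q K s s2) by (apply framed_thenN; auto).
  assert (Hr2 : ready K N s2) by (apply (framed_ready l q K N s); auto; lia).
  assert (C1 : snd s2 (S l) = 0%nat) by apply updN_same.
  assert (C2 : snd s2 l = denN c (snd s) (input_view s)).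
  { unfold s2; simpl. rewrite updN_diff by lia. auto. }
  cbn [denN costN]. destruct (Nat.ltb_spec 0 (denN c (snd s) (input_view s))) as [H|H].
  - destruct (Ha l q K N s2) as (s3 & t3 & E3 & T3 & D3 & F3); auto;
      try (unfold var_reg; lia).
    exists s3, (t1 + (1 + S t3))%nat. split; [|split; [|split]].
    + apply ESeq with s1; auto. apply ESeq with s2; auto. apply EIfNT; auto; lia.
    + simpl in *; lia.
    + rewrite D3. apply (denN_framed a l q K N); auto; unfold var_reg; lia.
    + apply (framed_trans l q K l q s s2 s3); auto.
  - destruct (Hb l q K N s2) as (s3 & t3 & E3 & T3 & D3 & F3); auto;
      try (unfold var_reg; lia).
    exists s3, (t1 + (1 + S (S t3)))%nat. split; [|split; [|split]].
    + apply ESeq with s1; auto. apply ESeq with s2; auto. apply EIfNF; auto; lia.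
    + simpl in *; lia.
    + rewrite D3. apply (denN_framed b l q K N); auto; unfold var_reg; lia.
    + apply (framed_trans l q K l q s s2 s3); auto.
Qed.

Lemma computes_ifR c a b :
  computesN c -> computesR a -> computesR b -> computesR (RIf c a b).
Proof.
  intros Hc Ha Hb l q K N s Hl Hq Hr. cbn [varsR rdepthR] in *. unfold var_reg in Hl.
  destruct (Hc l q K N s) as (s1 & t1 & E1 & T1 & D1 & F1); auto;
    try (unfold var_reg; lia).
  set (s2 := (fst s1, updN (snd s1) (S l) 0)).
  assert (E2 : exec (Prim (NConst (S l) 0)) s1 s2 1)
    by (apply EPrim; destruct s1; reflexivity).
  assert (F2 : framed l q K s s2) by (apply framed_thenN; auto).
  assert (Hr2 : ready K N s2) by (apply (framed_ready l q K N s); auto; lia).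
  assert (C1 : snd s2 (S l) = 0%nat) by apply updN_same.
  assert (C2 : snd s2 l = denN c (snd s) (input_view s)).
  { unfold s2; simpl. rewrite updN_diff by lia. auto. }
  cbn [denR costR]. destruct (Nat.ltb_spec 0 (denN c (snd s) (input_view s))) as [H|H].
  - destruct (Ha l q K N s2) as (s3 & t3 & E3 & T3 & D3 & F3); auto;
      try (unfold var_reg; lia).
    exists s3, (t1 + (1 + S t3))%nat. split; [|split; [|split]].
    + apply ESeq with s1; auto. apply ESeq with s2; auto. apply EIfNT; auto; lia.
    + simpl in *; lia.
    + rewrite D3. apply (denR_framed a l q K N); auto; unfold var_reg; lia.
    + apply (framed_trans l q K l q s s2 s3); auto.
  - destruct (Hb l q K N s2) as (s3 & t3 & E3 & T3 & D3 & F3); auto;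
      try (unfold var_reg; lia).
    exists s3, (t1 + (1 + S (S t3)))%nat. split; [|split; [|split]].
    + apply ESeq with s1; auto. apply ESeq with s2; auto. apply EIfNF; auto; lia.
    + simpl in *; lia.
    + rewrite D3. apply (denR_framed b l q K N); auto; unfold var_reg; lia.
    + apply (framed_trans l q K l q s s2 s3); auto.
Qed.

Lemma computes_binN (op : nexp -> nexp -> nexp) (i : nat -> instr)
    (f : nat -> nat -> nat) a b :
  (op = NPlus /\ i = (fun l => NAdd l l (S l)) /\ f = Nat.add) \/
  (op = NMinus /\ i = (fun l => NSub l l (S l)) /\ f = Nat.sub) ->
  computesN a -> computesN b -> computesN (op a b).
Proof.
  intros Hop Ha Hb l q K N s Hl Hq Hr.
  destruct (pair_N a b l q K N s) as (s1 & s2 & t1 & t2 & E1 & E2 & T & D1 & D2 & F);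
    auto; try solve [destruct Hop as [(-> & _)|(-> & _)]; assumption].
  exists (fst s2, updN (snd s2) l (f (snd s2 l) (snd s2 (S l)))), (t1 + (t2 + 1))%nat.
  split; [|split; [|split]].
  - destruct s2, Hop as [(-> & -> & ->)|(-> & -> & ->)]; simpl;
      (eapply ESeq; [exact E1|]; eapply ESeq; [exact E2|]; apply EPrim; reflexivity).
  - destruct Hop as [(-> & -> & ->)|(-> & -> & ->)]; simpl; lia.
  - simpl. rewrite updN_same, D1, D2.
    destruct Hop as [(-> & -> & ->)|(-> & -> & ->)]; reflexivity.
  - apply framed_thenN; auto.
Qed.

Lemma computes_binR (op : rexp -> rexp -> rexp) (i : nat -> instr)
    (f : R -> R -> R) a b :
  (op = RPlus /\ i = (fun q => RAdd q q (S q)) /\ f = Rplus) \/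
  (op = RMinus /\ i = (fun q => RSub q q (S q)) /\ f = Rminus) \/
  (op = RTimes /\ i = (fun q => RMul q q (S q)) /\ f = Rmult) ->
  computesR a -> computesR b -> computesR (op a b).
Proof.
  intros Hop Ha Hb l q K N s Hl Hq Hr.
  destruct (pair_R a b l q K N s) as (s1 & s2 & t1 & t2 & E1 & E2 & T & D1 & D2 & F);
    auto; try solve [destruct Hop as [(-> & _)|[(-> & _)|(-> & _)]]; assumption].
  exists (updR (fst s2) q (f (fst s2 q) (fst s2 (S q))), snd s2), (t1 + (t2 + 1))%nat.
  split; [|split; [|split]].
  - destruct s2, Hop as [(-> & -> & ->)|[(-> & -> & ->)|(-> & -> & ->)]]; simpl;
      (eapply ESeq; [exact E1|]; eapply ESeq; [exact E2|]; apply EPrim; reflexivity).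
  - destruct Hop as [(-> & -> & ->)|[(-> & -> & ->)|(-> & -> & ->)]]; simpl; lia.
  - simpl. rewrite updR_same, D1, D2.
    destruct Hop as [(-> & -> & ->)|[(-> & -> & ->)|(-> & -> & ->)]]; reflexivity.
  - apply framed_thenR; auto.
    destruct Hop as [(-> & _)|[(-> & _)|(-> & _)]]; simpl in Hq; lia.
Qed.

Lemma comp_correct : (forall e, computesN e) /\ (forall e, computesR e).
Proof.
  apply exp_ind.
  - intros c l q K N s Hl Hq Hr. exists (fst s, updN (snd s) l c), 1%nat.
    split; [apply EPrim; destruct s; reflexivity|split; [simpl; lia|split]].
    + apply updN_same.
    + apply framed_updN; auto.
  - intros x l q K N s Hl Hq Hr. simpl in Hl.
    exists (fst s, updN (updN (snd s) l 0) l (snd s (var_reg x))), 2%nat.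
    split; [apply exec_move; unfold var_reg in *; lia|split; [simpl; lia|split]].
    + apply updN_same.
    + apply (framed_thenN l q K s (fst s, updN (snd s) l 0)); auto.
      apply framed_updN; auto.
  - intros b l q K N s Hl Hq Hr. pose proof (lim_reg_lt b).
    exists (fst s, updN (updN (snd s) l 0) l (snd s (lim_reg b))), 2%nat.
    split; [apply exec_move; unfold var_reg in *; lia|split; [simpl; lia|split]].
    + apply updN_same.
    + apply (framed_thenN l q K s (fst s, updN (snd s) l 0)); auto.
      apply framed_updN; auto.
  - intros a Ha b Hb. exact (computes_binN NPlus _ _ a b (or_introl (conj eq_refl (conj eq_refl eq_refl))) Ha Hb).
  - intros a Ha b Hb. exact (computes_binN NMinus _ _ a b (or_intror (conj eq_refl (conj eq_refl eq_refl))) Ha Hb).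
  - intros a Ha b Hb l q K N s Hl Hq Hr.
    destruct (pair_N a b l q K N s) as (s1 & s2 & t1 & t2 & E1 & E2 & T & D1 & D2 & F);
      auto.
    cbn [denN costN compN].
    destruct (Nat.ltb_spec (denN a (snd s) (input_view s)) (denN b (snd s) (input_view s))).
    + exists (fst s2, updN (snd s2) l 1), (t1 + (t2 + 2))%nat.
      split; [|split; [|split]].
      * apply ESeq with s1; auto. apply ESeq with s2; auto. apply EIfNT; [lia|].
        apply EPrim; destruct s2; reflexivity.
      * lia.
      * apply updN_same.
      * apply framed_thenN; auto.
    + exists (fst s2, updN (snd s2) l 0), (t1 + (t2 + 3))%nat.
      split; [|split; [|split]].
      * apply ESeq with s1; auto. apply ESeq with s2; auto. apply EIfNF; [lia|].
        apply EPrim; destruct s2; reflexivity.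
      * lia.
      * apply updN_same.
      * apply framed_thenN; auto.
  - intros a Ha b Hb l q K N s Hl Hq Hr.
    destruct (pair_R a b l q K N s) as (s1 & s2 & t1 & t2 & E1 & E2 & T & D1 & D2 & F);
      auto.
    cbn [denN costN compN].
    destruct (Rlt_dec (denR a (snd s) (input_view s)) (denR b (snd s) (input_view s))).
    + exists (fst s2, updN (snd s2) l 1), (t1 + (t2 + 2))%nat.
      split; [|split; [|split]].
      * apply ESeq with s1; auto. apply ESeq with s2; auto.
        apply EIfRT; [rewrite D1, D2; auto|]. apply EPrim; destruct s2; reflexivity.
      * lia.
      * apply updN_same.
      * apply framed_thenN; auto.
    + exists (fst s2, updN (snd s2) l 0), (t1 + (t2 + 3))%nat.
      split; [|split; [|split]].
      * apply ESeq with s1; auto. apply ESeq with s2; auto.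
        apply EIfRF; [rewrite D1, D2; auto|]. apply EPrim; destruct s2; reflexivity.
      * lia.
      * apply updN_same.
      * apply framed_thenN; auto.
  - intros; apply computes_ifN; auto.
  - intros; apply computes_sumN; auto.
  - intros z w l q K N s Hl Hq Hr. simpl in Hq.
    set (r1 := updR (fst s) q (IZR z)).
    set (r2 := updR r1 (S q) (IZR (Zpos w))).
    assert (Q1 : r2 q = IZR z).
    { unfold r2, r1. rewrite updR_diff by lia. apply updR_same. }
    assert (Q2 : r2 (S q) = IZR (Zpos w)) by apply updR_same.
    exists (updR r2 q (r2 q / r2 (S q)), snd s), (1 + (1 + 1))%nat.
    split; [|split; [|split]].
    + apply ESeq with (r1, snd s); [apply EPrim; destruct s; reflexivity|].
      apply ESeq with (r2, snd s); apply EPrim; [reflexivity|].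
      (* The denominator is a [positive], so the division is not stuck. *)
      cbn [prim_exec]. destruct (Req_EM_T (r2 (S q)) 0) as [H|H]; [|reflexivity].
      rewrite Q2 in H. apply eq_IZR in H. discriminate.
    + simpl; lia.
    + simpl. rewrite updR_same, Q1, Q2. reflexivity.
    + apply (framed_thenR l q K s (r2, snd s)); [lia|].
      apply (framed_thenR l q K s (r1, snd s)); [lia|].
      apply framed_updR; lia.
  - intros a Ha l q K N s Hl Hq Hr. cbn [varsR rdepthR] in *.
    destruct (Ha l q K N s) as (s1 & t1 & E1 & T1 & D1 & F1); auto; [lia|].
    set (ix2 := updN (snd s1) l (snd s1 l + snd s1 off_reg)).
    exists (updR (fst s1) q (fst s1 (ix2 l)), ix2), (t1 + (1 + 1))%nat.
    split; [|split; [|split]].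
    + apply ESeq with s1; auto.
      apply ESeq with (fst s1, ix2); apply EPrim; [destruct s1|]; reflexivity.
    + simpl; lia.
    + cbn [fst denR]. rewrite updR_same. unfold ix2. rewrite updN_same, D1.
      destruct F1 as [F1 F2].
      rewrite F1 by (unfold off_reg, var_reg in *; lia).
      destruct Hr as [Hr _]. rewrite F2 by lia.
      unfold input_view. f_equal; lia.
    + apply (framed_thenR l q K s (fst s1, ix2)); [lia|]. apply framed_thenN; auto.
  - intros a Ha b Hb. exact (computes_binR RPlus _ _ a b (or_introl (conj eq_refl (conj eq_refl eq_refl))) Ha Hb).
  - intros a Ha b Hb. exact (computes_binR RMinus _ _ a b (or_intror (or_introl (conj eq_refl (conj eq_refl eq_refl)))) Ha Hb).
  - intros a Ha b Hb. exact (computes_binR RTimes _ _ a b (or_intror (or_intror (conj eq_refl (conj eq_refl eq_refl)))) Ha Hb).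
  - intros; apply computes_ifR; auto.
  - intros; apply computes_sumR; auto.
Qed.

(** * Relocation of the input, and the decision program of an expression *)

Definition input_length (n m d : nat) : nat := (1 + n + (n + m) * d)%nat.

(** Indices cannot be multiplied by the machine, so [d * (n + m)] is accumulated in register 4 by
    repeated addition, with counter 5, summand 6 and the constant 1 in register 7. The offset is [K]
    plus the input length, so source and copy are disjoint. Real register 0 is the transfer buffer;
    it initially holds [eps], which is copied first. *)
Definition relocate (K : nat) : cmd :=
  Prim (NAdd 6 0 1) ;; Prim (NConst 7 1) ;;
  WhileLt 5 2 (Prim (NAdd 4 4 6) ;; Prim (NAdd 5 5 7)) ;;
  Prim (NAdd 4 4 0) ;; Prim (NAdd 4 4 7) ;;
  Prim (NConst off_reg K) ;; Prim (NAdd off_reg off_reg 4) ;;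
  Prim (NConst 5 0) ;;
  WhileLt 5 4
    (Prim (RLoad 0 5) ;; Prim (NAdd 6 5 off_reg) ;; Prim (RStore 6 0) ;;
     Prim (NAdd 5 5 7)).

Lemma mul_loop d w r : forall rem i ix,
  (i + rem = d)%nat -> ix 2%nat = d -> ix 5%nat = i -> ix 6%nat = w ->
  ix 7%nat = 1%nat ->
  exists ix' t,
    exec (WhileLt 5 2 (Prim (NAdd 4 4 6) ;; Prim (NAdd 5 5 7))) (r, ix) (r, ix') t /\
    (t <= rem * 4 + 2)%nat /\ ix' 4%nat = (ix 4%nat + rem * w)%nat /\
    (forall k, k <> 4%nat -> k <> 5%nat -> ix' k = ix k).
Proof.
  induction rem as [|rem IH]; intros i ix Hi H2 H5 H6 H7.
  - exists ix, 2%nat. repeat split; auto; try lia. apply EWhileF. simpl; lia.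
  - set (ix1 := updN ix 4 (ix 4 + ix 6)%nat).
    set (ix2 := updN ix1 5 (ix1 5 + ix1 7)%nat).
    assert (A : forall k, k <> 4%nat -> k <> 5%nat -> ix2 k = ix k).
    { intros k ? ?. unfold ix2, ix1. rewrite !updN_diff by lia. reflexivity. }
    destruct (IH (S i) ix2) as (ix' & t & E & T & G1 & G2);
      try (rewrite A by lia; auto); [lia| |].
    { unfold ix2, ix1. rewrite updN_same, !updN_diff by lia. lia. }
    exists ix', (S (S ((1 + 1) + t))). repeat split.
    + apply EWhileT with (r, ix2); [simpl; lia| |exact E].
      apply ESeq with (r, ix1); apply EPrim; reflexivity.
    + lia.
    + rewrite G1. unfold ix2, ix1. rewrite updN_diff by lia. rewrite updN_same. lia.
    + intros k ? ?. rewrite G2, A; auto.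
Qed.

(** Register 0 is the buffer, so its content is trusted only at the first turn, whereas the sources
    at positive addresses from [i] on are still intact. *)
Lemma copy_loop tot K r0 : forall rem i r ix,
  (i + rem = tot)%nat -> ix 4%nat = tot -> ix 5%nat = i -> ix 7%nat = 1%nat ->
  ix off_reg = (K + tot)%nat ->
  (forall a, (i <= a < tot)%nat -> (0 < a)%nat -> r a = r0 a) ->
  (i = 0%nat -> r 0%nat = r0 0%nat) ->
  (forall a, (a < i)%nat -> r (K + tot + a)%nat = r0 a) ->
  exists r' ix' t,
    exec (WhileLt 5 4
      (Prim (RLoad 0 5) ;; Prim (NAdd 6 5 off_reg) ;; Prim (RStore 6 0) ;;
       Prim (NAdd 5 5 7))) (r, ix) (r', ix') t /\
    (t <= rem * 6 + 2)%nat /\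
    (forall a, (a < tot)%nat -> r' (K + tot + a)%nat = r0 a) /\
    (forall k, k <> 5%nat -> k <> 6%nat -> ix' k = ix k).
Proof.
  induction rem as [|rem IH]; intros i r ix Hi H4 H5 H7 H3 Hr Hr0 Hc.
  - exists r, ix, 2%nat. repeat split; auto; try lia.
    + apply EWhileF. simpl; lia.
    + intros a Ha; apply Hc; lia.
  - set (r1 := updR r 0 (r (ix 5%nat))).
    set (ix2 := updN ix 6 (ix 5 + ix off_reg)%nat).
    set (r3 := updR r1 (ix2 6%nat) (r1 0%nat)).
    set (ix4 := updN ix2 5 (ix2 5 + ix2 7)%nat).
    assert (A : forall k, k <> 5%nat -> k <> 6%nat -> ix4 k = ix k).
    { intros k ? ?. unfold ix4, ix2. rewrite !updN_diff by lia. reflexivity. }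
    assert (Hdst : ix2 6%nat = (K + tot + i)%nat).
    { unfold ix2. rewrite updN_same. lia. }
    assert (Hv : r1 0%nat = r0 i).
    { unfold r1. rewrite updR_same, H5. destruct i; [auto|]. apply Hr; lia. }
    destruct (IH (S i) r3 ix4) as (r' & ix' & t & E & T & G1 & G2);
      try (rewrite A by (unfold off_reg; lia); auto); try lia.
    { unfold ix4, ix2. rewrite updN_same, !updN_diff by lia. lia. }
    { intros a Ha Ha'. unfold r3, r1. rewrite Hdst, !updR_diff by lia. apply Hr; lia. }
    { intros a Ha. unfold r3. rewrite Hdst.
      destruct (Nat.eq_dec a i) as [->|Hn].
      - rewrite updR_same. exact Hv.
      - rewrite updR_diff by lia. unfold r1. rewrite updR_diff by lia.
        apply Hc; lia. }
    exists r', ix', (S (S ((1 + (1 + (1 + 1))) + t))). repeat split; auto.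
    + apply EWhileT with (r3, ix4); [simpl; lia| |exact E].
      apply ESeq with (r1, ix); [apply EPrim; reflexivity|].
      apply ESeq with (r1, ix2); [apply EPrim; reflexivity|].
      apply ESeq with (r3, ix2); apply EPrim; reflexivity.
    + lia.
    + intros k ? ?. rewrite G2, A; auto.
Qed.

Lemma relocate_correct K n m d r0 :
  exists s' t, exec (relocate K) (r0, init_nmem n m d) s' t /\
    (t <= 6 * (d + input_length n m d) + 20)%nat /\
    snd s' 0%nat = n /\ snd s' 2%nat = d /\ (K <= snd s' off_reg)%nat /\
    (forall a, (a < input_length n m d)%nat -> input_view s' a = r0 a).
Proof.
  set (ix0 := init_nmem n m d).
  set (ix1 := updN ix0 6 (ix0 0 + ix0 1)%nat).
  set (ix2 := updN ix1 7 1).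
  destruct (mul_loop d (n + m) r0 d 0 ix2) as (ix3 & t3 & E3 & T3 & G1 & G2); auto.
  assert (I4 : ix3 4%nat = (d * (n + m))%nat) by (rewrite G1; reflexivity).
  assert (I0 : ix3 0%nat = n) by (rewrite G2 by lia; reflexivity).
  assert (I2 : ix3 2%nat = d) by (rewrite G2 by lia; reflexivity).
  assert (I7 : ix3 7%nat = 1%nat) by (rewrite G2 by lia; reflexivity).
  set (ix4 := updN ix3 4 (ix3 4 + ix3 0)%nat).
  set (ix5 := updN ix4 4 (ix4 4 + ix4 7)%nat).
  set (ix6 := updN ix5 off_reg K).
  set (ix7 := updN ix6 off_reg (ix6 off_reg + ix6 4)%nat).
  set (ix8 := updN ix7 5 0).
  assert (Htot : ix8 4%nat = input_length n m d).
  { change (ix8 4%nat) with (ix3 4 + ix3 0 + ix3 7)%nat.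
    rewrite I4, I0, I7. unfold input_length. lia. }
  assert (Hoff : ix8 off_reg = (K + input_length n m d)%nat).
  { change (ix8 off_reg) with (K + ix8 4)%nat. rewrite Htot. reflexivity. }
  destruct (copy_loop (input_length n m d) K r0 (input_length n m d) 0 r0 ix8)
    as (r' & ix' & t & E & T & G3 & G4); auto; try lia.
  exists (r', ix'), (1 + (1 + (t3 + (1 + (1 + (1 + (1 + (1 + t))))))))%nat.
  repeat split; cbn [snd].
  - apply ESeq with (r0, ix1); [apply EPrim; reflexivity|].
    apply ESeq with (r0, ix2); [apply EPrim; reflexivity|].
    apply ESeq with (r0, ix3); [exact E3|].
    apply ESeq with (r0, ix4); [apply EPrim; reflexivity|].
    apply ESeq with (r0, ix5); [apply EPrim; reflexivity|].
    apply ESeq with (r0, ix6); [apply EPrim; reflexivity|].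
    apply ESeq with (r0, ix7); [apply EPrim; reflexivity|].
    apply ESeq with (r0, ix8); [apply EPrim; reflexivity|]. exact E.
  - lia.
  - rewrite G4 by lia. exact I0.
  - rewrite G4 by lia. exact I2.
  - rewrite G4, Hoff by (unfold off_reg; lia). lia.
  - intros a Ha. unfold input_view; cbn [fst snd].
    rewrite G4, Hoff by (unfold off_reg; lia). apply G3; auto.
Qed.

Definition decider (e : nexp) : program :=
  let l := var_reg (varsN e) in
  let c := relocate (rdepthN e) ;; compN e l 0 ;; Prim (NConst (S l) 0) in
  code 0 c ++ [JNLt (S l) l (2 + code_size c); Halt false; Halt true].

(** The hypothesis is required for every [ix] with the right limits, since after relocation the
    registers of program variables hold leftovers. The expression may depend on [m], but on nothing
    else of the instance. *)
Lemma expression_decides (m : nat) (e : nexp)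
    (Q : nat -> nat -> nat -> R -> (nat -> R) -> (nat -> nat -> R) ->
         (nat -> nat -> R) -> Prop) :
  (forall n d eps f C V, valid_instance n m d eps f C V ->
     forall ix M, ix 0%nat = n -> ix 2%nat = d ->
     (forall a, (a < input_length n m d)%nat -> M a = init_rmem n m d eps f C V a) ->
     (0 < denN e ix M)%nat <-> Q n m d eps f C V) ->
  poly_decides_fixed_m m Q.
Proof.
  intros HQ. exists (decider e).
  (* Relocation takes at most [6 * (N + N) + 20] steps; the remaining 4 cover the constant 0, the
     final test and the halt. *)
  destruct (poly_bounded_add (fun N => 12 * N + 24)%nat (costN e)) as (c & k & Hck).
  { repeat first [ apply poly_bounded_add | apply poly_bounded_mul
                 | apply poly_bounded_const | apply poly_bounded_id ]. }
  { apply cost_poly_bounded. }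
  exists c, k. intros n d eps f C V Hv.
  set (N := input_size n m d).
  assert (HN : (1 <= N)%nat) by (unfold N, input_size; lia).
  specialize (Hck N HN).
  assert (Hn : (1 <= n)%nat) by apply Hv.
  (* [d] enters the input size through the coordinates of the points, so there must be at least one
     candidate. *)
  assert (Hd : (d <= N)%nat) by (unfold N, input_size; nia).
  assert (Hl : (input_length n m d <= N)%nat)
    by (unfold N, input_size, input_length; lia).
  set (r0 := init_rmem n m d eps f C V).
  destruct (relocate_correct (rdepthN e) n m d r0)
    as (s1 & t1 & E1 & T1 & A0 & A2 & A3 & AM).
  set (l := var_reg (varsN e)).
  assert (Hready : ready (rdepthN e) N s1).
  { split; auto. intros []; simpl; [lia|]. rewrite A0. unfold N, input_size; lia. }
  destruct (proj1 comp_correct e l 0%nat (rdepthN e) N s1)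
    as (s2 & t2 & E2 & T2 & D & F); auto; try lia.
  set (s3 := (fst s2, updN (snd s2) (S l) 0)).
  set (cc := relocate (rdepthN e) ;; compN e l 0 ;; Prim (NConst (S l) 0)).
  assert (E : exec cc (r0, init_nmem n m d) s3 (t1 + (t2 + 1))).
  { apply ESeq with s1; auto. apply ESeq with s2; auto.
    apply EPrim; destruct s2; reflexivity. }
  assert (HP : decider e = code 0 cc ++ [JNLt (S l) l (2 + code_size cc); Halt false; Halt true])
    by reflexivity.
  assert (HP1 : code_at (decider e) 0 (code 0 cc ++ [JNLt (S l) l (2 + code_size cc); Halt false; Halt true])).
  { rewrite HP. intros j _. reflexivity. }
  apply code_at_app in HP1 as [HP1 HP2]. rewrite code_length in HP2.
  apply code_at_cons in HP2 as [HJ HP2]. apply code_at_cons in HP2 as [HF HP2].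
  apply code_at_cons in HP2 as [HT _].
  exists (Nat.ltb 0 (denN e (snd s1) (input_view s1))). split.
  - assert (Hfuel : exists fuel, (c * N ^ k = (t1 + (t2 + 1)) + S (S fuel))%nat).
    { exists (c * N ^ k - (t1 + (t2 + 1)) - 2)%nat. lia. }
    destruct Hfuel as [fuel ->].
    change (init_config n m d eps f C V) with (conf 0 (r0, init_nmem n m d)).
    rewrite (exec_run _ _ _ _ E _ _ HP1).
    rewrite (run_step _ _ _ _ (step_jnlt _ _ _ _ _ _ HJ)).
    replace (snd s3 (S l)) with 0%nat by (symmetry; apply updN_same).
    replace (snd s3 l) with (denN e (snd s1) (input_view s1)).
    2:{ unfold s3; cbn [snd]. rewrite updN_diff by lia. auto. }
    change (0 + code_size cc)%nat with (code_size cc) in *.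
    destruct (Nat.ltb 0 _); cbn [run]; unfold step; cbn [conf Defs.pc];
      change (2 + code_size cc)%nat with (S (S (code_size cc))); rewrite ?HF, ?HT; reflexivity.
  - rewrite Nat.ltb_lt. apply (HQ n d eps f C V Hv); auto.
Qed.

(** * Reduction of the dimension *)

Definition dot (d : nat) (x y : nat -> R) : R := sumR d (fun k => x k * y k).

Definition vsub (x y : nat -> R) : nat -> R := fun k => x k - y k.

Lemma sumR_add N g h : sumR N (fun k => g k + h k) = sumR N g + sumR N h.
Proof. induction N; simpl; [ring|rewrite IHN; ring]. Qed.

Lemma sumR_scal N c g : sumR N (fun k => c * g k) = c * sumR N g.
Proof. induction N; simpl; [ring|rewrite IHN; ring]. Qed.

Lemma sumR_le N g h : (forall k, (k < N)%nat -> g k <= h k) -> sumR N g <= sumR N h.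
Proof.
  induction N; simpl; intros H; [apply Rle_refl|].
  apply Rplus_le_compat; [apply IHN|]; auto.
Qed.

Lemma sumR_tail0 N N' g :
  (N <= N')%nat -> (forall k, (N <= k < N')%nat -> g k = 0) -> sumR N' g = sumR N g.
Proof.
  intros H; induction H as [|N' H IH]; intros Hg; auto.
  simpl. rewrite IH by (intros; apply Hg; lia). rewrite Hg by lia. ring.
Qed.

Lemma dot_comm d x y : dot d x y = dot d y x.
Proof. apply sumR_ext; intros; ring. Qed.

Lemma dot_ext d x y x' y' :
  (forall k, (k < d)%nat -> x k = x' k) -> (forall k, (k < d)%nat -> y k = y' k) ->
  dot d x y = dot d x' y'.
Proof. intros H1 H2; apply sumR_ext; intros; rewrite H1, H2; auto. Qed.

Lemma dot_linear d c x y z :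
  dot d (fun k => x k + c * y k) z = dot d x z + c * dot d y z.
Proof.
  unfold dot. rewrite <- sumR_scal, <- sumR_add. apply sumR_ext; intros; ring.
Qed.

Lemma dot_vsub_l d x y z : dot d (vsub x y) z = dot d x z - dot d y z.
Proof.
  transitivity (dot d (fun k => x k + (-1) * y k) z).
  - apply dot_ext; intros; unfold vsub; ring.
  - rewrite dot_linear; ring.
Qed.

Lemma dot_vsub_sq d x y :
  dot d (vsub x y) (vsub x y) = dot d x x - 2 * dot d x y + dot d y y.
Proof.
  rewrite dot_vsub_l, !(dot_comm d _ (vsub x y)), !dot_vsub_l, (dot_comm d y x). ring.
Qed.

Lemma dot_sq_nonneg d x : 0 <= dot d x x.
Proof.
  replace 0 with (sumR d (fun _ => 0)).
  - apply sumR_le; intros; nra.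
  - induction d; simpl; [|rewrite IHd]; lra.
Qed.

Lemma dot_sq_zero d x : dot d x x = 0 -> forall k, (k < d)%nat -> x k = 0.
Proof.
  induction d as [|d IH]; intros H k Hk; [lia|].
  unfold dot in H; simpl in H. fold (dot d x x) in H.
  pose proof (dot_sq_nonneg d x).
  destruct (Nat.eq_dec k d) as [->|Hn]; [nra|].
  apply IH; [nra|lia].
Qed.

Lemma sqdist_dot d x y : sqdist d x y = dot d (vsub x y) (vsub x y).
Proof. apply sumR_ext; intros; unfold vsub; ring. Qed.

Definition isometry (d : nat) (T : (nat -> R) -> nat -> R) : Prop :=
  forall a b, dot d (T a) (T b) = dot d a b.

(* The Householder reflection in the hyperplane orthogonal to [z - x]. *)
Lemma reflection d z x :
  dot d z z = dot d x x ->
  exists H, isometry d H /\ (forall k, (k < d)%nat -> H z k = x k) /\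
    forall a, dot d (vsub z x) a = 0 -> forall k, (k < d)%nat -> H a k = a k.
Proof.
  intros Hzx. set (w := vsub z x).
  destruct (Req_dec (dot d w w) 0) as [H0|H0].
  - exists (fun a => a). repeat split; auto.
    intros k Hk. pose proof (dot_sq_zero d w H0 k Hk) as E. unfold w, vsub in E. lra.
  - exists (fun a k => a k + (- 2 * dot d w a / dot d w w) * w k).
    (* Equal norms make the coefficient of the reflection at [z] equal to -1, so [z] goes to
       [z - w = x]. *)
    assert (Hwz : dot d w w = 2 * dot d w z).
    { unfold w. rewrite dot_vsub_sq, dot_vsub_l, (dot_comm d x z). lra. }
    split; [|split].
    + intros a b. set (s := -2 * dot d w a / _). set (t := -2 * dot d w b / _).
      transitivity (dot d a b + s * dot d w b + t * (dot d w a + s * dot d w w)).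
      * rewrite dot_linear, (dot_comm d a), (dot_comm d w (fun _ => _)), !dot_linear.
        rewrite (dot_comm d b a), (dot_comm d b w). ring.
      * unfold s, t. field; auto.
    + intros k Hk. simpl. replace (-2 * dot d w z / dot d w w) with (-1).
      * unfold w, vsub; ring.
      * rewrite Hwz. field. lra.
    + intros a Ha k Hk. fold w in Ha. rewrite Ha. unfold Rdiv; ring.
Qed.

(** Reflections are composed one vector at a time. The one taking the image of [x N] to [x' N] fixes
    each earlier [x' i], because equal Gram entries make [x' i] orthogonal to the difference of the
    two. *)
Lemma gram_isometry d N (x x' : nat -> nat -> R) :
  (forall i j, (i < N)%nat -> (j < N)%nat -> dot d (x i) (x j) = dot d (x' i) (x' j)) ->
  exists T, isometry d T /\
    forall i k, (i < N)%nat -> (k < d)%nat -> T (x i) k = x' i k.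
Proof.
  induction N as [|N IH]; intros HG.
  - exists (fun a => a). split; [intros a b; auto|intros; lia].
  - destruct IH as (T & HT & Hx); [intros; apply HG; lia|].
    destruct (reflection d (T (x N)) (x' N)) as (H & HH & Hz & Hfix).
    { rewrite HT. apply HG; lia. }
    exists (fun a => H (T a)). split; [intros a b; rewrite HH; apply HT|].
    intros i k Hi Hk. destruct (Nat.eq_dec i N) as [->|Hn]; [auto|].
    rewrite Hfix; [apply Hx; lia| |auto].
    rewrite dot_vsub_l, HT.
    rewrite (dot_ext d (x' N) (T (x i)) (x' N) (x' i)) by (auto; intros; apply Hx; lia).
    rewrite (HG N i) by lia. ring.
Qed.

(** This is the QR decomposition by Householder reflections. *)
Lemma triangular_isometry d N (x : nat -> nat -> R) :
  exists T, isometry d T /\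
    forall i k, (i < N)%nat -> (i < k < d)%nat -> T (x i) k = 0.
Proof.
  induction N as [|N IH].
  - exists (fun a => a). split; [intros a b; auto|intros; lia].
  - destruct IH as (T & HT & Hx).
    destruct (le_lt_dec d N) as [Hd|Hd].
    { exists T. split; auto. intros i k Hi Hk. apply Hx; lia. }
    set (z := T (x N)).
    (* [x'] keeps the first [N] coordinates of [z] and puts the norm of the rest at coordinate [N].
       It thus has the norm of [z], and [z - x'] is supported where the earlier images vanish, so
       these stay fixed. *)
    set (tail := fun k => if Nat.ltb k N then 0 else z k).
    set (x' := fun k => if Nat.ltb k N then z k
                        else if Nat.eqb k N then sqrt (dot d tail tail) else 0).
    destruct (reflection d z x') as (H & HH & Hz & Hfix).
    { assert (E : dot d z z = dot N z z + dot d tail tail).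
      { transitivity (dot d (fun k => if Nat.ltb k N then z k else 0)
                            (fun k => if Nat.ltb k N then z k else 0) + dot d tail tail).
        - unfold dot. rewrite <- sumR_add. apply sumR_ext; intros k _.
          unfold tail. destruct (Nat.ltb k N); ring.
        - f_equal. unfold dot. rewrite (sumR_tail0 N d); [|lia|].
          + apply sumR_ext; intros k Hk. apply Nat.ltb_lt in Hk. rewrite Hk. auto.
          + intros k Hk. destruct (Nat.ltb_spec k N); [lia|ring]. }
      rewrite E. unfold dot at 3. rewrite (sumR_tail0 (S N) d); [|lia|].
      - simpl. f_equal.
        + apply sumR_ext; intros k Hk. unfold x'. apply Nat.ltb_lt in Hk.
          rewrite Hk. auto.
        + unfold x'. rewrite Nat.ltb_irrefl, Nat.eqb_refl.
          symmetry; apply sqrt_sqrt, dot_sq_nonneg.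
      - intros k Hk. unfold x'. destruct (Nat.ltb_spec k N); [lia|].
        destruct (Nat.eqb_spec k N); [lia|ring]. }
    exists (fun a => H (T a)). split; [intros a b; rewrite HH; apply HT|].
    intros i k Hi Hk. destruct (Nat.eq_dec i N) as [->|Hn].
    + fold z. rewrite Hz by lia. unfold x'. destruct (Nat.ltb_spec k N); [lia|].
      destruct (Nat.eqb_spec k N); [lia|auto].
    + rewrite Hfix; [apply Hx; lia| |lia].
      unfold dot. rewrite (sumR_tail0 0 d); [reflexivity|lia|].
      intros j Hj. unfold vsub, x'. destruct (Nat.ltb_spec j N); [ring|].
      rewrite Hx by lia. ring.
Qed.

(** * Feasibility of distance constraints, and its reduction to dimension [m + 1] *)

Definition within (constructive : bool) (a b : R) : Prop :=
  if constructive then a <= b else b <= a.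

(* The points at distance at most [sqrt e2] from the origin satisfying the
   distance constraints [B] to a family with Gram matrix [G] in dimension [D]. *)
Definition feasible (c : bool) (m D : nat) (e2 : R) (G : nat -> nat -> R)
    (B : nat -> R) : Prop :=
  exists (u : nat -> nat -> R) (y : nat -> R),
    (forall i j, (i < m)%nat -> (j < m)%nat -> dot D (u i) (u j) = G i j) /\
    dot D y y <= e2 /\
    forall i, (i < m)%nat -> within c (dot D (vsub y (u i)) (vsub y (u i))) (B i).

Lemma feasible_ext c m D e2 e2' G G' B B' :
  e2 = e2' -> (forall i j, (i < m)%nat -> (j < m)%nat -> G i j = G' i j) ->
  (forall i, (i < m)%nat -> B i = B' i) ->
  feasible c m D e2 G B -> feasible c m D e2' G' B'.
Proof.
  intros <- HG HB (u & y & H1 & H2 & H3). exists u, y. repeat split; auto.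
  - intros; rewrite <- HG; auto.
  - intros; rewrite <- HB; auto.
Qed.

(** A realisation of the Gram matrix by other vectors [u] is moved onto the vectors [V i - p] by an
    isometry, which carries [y] to the displacement of the target. *)
Lemma feasible_position c m d e2 (V : nat -> nat -> R) (p : nat -> R) B :
  (exists ct, sqdist d ct p <= e2 /\
     forall i, (i < m)%nat -> within c (sqdist d (V i) ct) (B i)) <->
  feasible c m d e2 (fun i j => dot d (vsub (V i) p) (vsub (V j) p)) B.
Proof.
  split.
  - intros (ct & H1 & H2). exists (fun i => vsub (V i) p), (vsub ct p).
    split; [|split]; auto.
    + rewrite <- sqdist_dot; auto.
    + intros i Hi. specialize (H2 i Hi). rewrite sqdist_dot in H2.
      replace (dot d _ _) with (dot d (vsub (V i) ct) (vsub (V i) ct)); auto.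
      apply sumR_ext; intros; unfold vsub; ring.
  - intros (u & y & H1 & H2 & H3).
    destruct (gram_isometry d m u (fun i => vsub (V i) p) H1) as (T & HT & Hu).
    exists (fun k => p k + T y k). split.
    + rewrite sqdist_dot.
      replace (dot d _ _) with (dot d (T y) (T y)).
      * rewrite HT; auto.
      * apply dot_ext; intros; unfold vsub; ring.
    + intros i Hi. rewrite sqdist_dot.
      replace (dot d _ _) with (dot d (vsub y (u i)) (vsub y (u i))); auto.
      transitivity (dot d (vsub (vsub (V i) p) (T y)) (vsub (vsub (V i) p) (T y)));
        [|apply dot_ext; intros; unfold vsub; ring].
      rewrite (dot_vsub_sq d y), (dot_vsub_sq d _ (T y)), HT, H1 by auto.
      rewrite (dot_ext d (vsub (V i) p) (T y) (T (u i)) (T y))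
        by (auto; intros; symmetry; auto).
      rewrite HT, (dot_comm d (u i) y). ring.
Qed.

(** The voters and the sought point are [m + 1] vectors, so after a triangular isometry all
    coordinates from [S m] on vanish and may be cut off; conversely, padding with zeros preserves
    all dot products. *)
Lemma feasible_dimension c m d e2 G B :
  (S m <= d)%nat -> feasible c m d e2 G B <-> feasible c m (S m) e2 G B.
Proof.
  intros Hd. split.
  - intros (u & y & H1 & H2 & H3).
    destruct (triangular_isometry d (S m) (fun i => if Nat.eqb i m then y else u i))
      as (T & HT & H0).
    assert (Hy : forall k, (S m <= k < d)%nat -> T y k = 0).
    { intros k Hk. specialize (H0 m k). rewrite Nat.eqb_refl in H0. apply H0; lia. }
    assert (Hu : forall i k, (i < m)%nat -> (S m <= k < d)%nat -> T (u i) k = 0).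
    { intros i k Hi Hk. specialize (H0 i k).
      destruct (Nat.eqb_spec i m); [lia|]. apply H0; lia. }
    assert (HD : forall a b, (forall k, (S m <= k < d)%nat -> a k = 0) ->
              dot (S m) a b = dot d a b).
    { intros a b Ha. symmetry. apply sumR_tail0; auto. intros k Hk. rewrite Ha; auto; ring. }
    exists (fun i => T (u i)), (T y). split; [|split].
    + intros i j Hi Hj. rewrite HD, HT by auto. auto.
    + rewrite HD, HT by auto. auto.
    + intros i Hi. rewrite dot_vsub_sq, !HD, !HT, <- dot_vsub_sq by auto. auto.
  - intros (u & y & H1 & H2 & H3).
    set (pad := fun (a : nat -> R) k => if Nat.ltb k (S m) then a k else 0).
    assert (HD : forall a b, dot d (pad a) (pad b) = dot (S m) a b).
    { intros a b. unfold dot. rewrite (sumR_tail0 (S m) d); auto.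
      - apply sumR_ext; intros k Hk. unfold pad. apply Nat.ltb_lt in Hk.
        rewrite Hk; auto.
      - intros k Hk. unfold pad. destruct (Nat.ltb_spec k (S m)); [lia|ring]. }
    exists (fun i => pad (u i)), (pad y). split; [|split].
    + intros i j Hi Hj. rewrite HD. auto.
    + rewrite HD. auto.
    + intros i Hi. rewrite dot_vsub_sq, !HD, <- dot_vsub_sq. auto.
Qed.

Lemma feasible_reduction c m d e2 (V : nat -> nat -> R) (p : nat -> R) B :
  (exists ct, sqdist d ct p <= e2 /\
     forall i, (i < m)%nat -> within c (sqdist d (V i) ct) (B i)) <->
  feasible c m (Nat.min d (S m)) e2
    (fun i j => dot d (vsub (V i) p) (vsub (V j) p)) B.
Proof.
  rewrite feasible_position. destruct (le_lt_dec (S m) d) as [H|H].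
  - rewrite Nat.min_r by lia. apply feasible_dimension; auto.
  - rewrite Nat.min_l by lia. reflexivity.
Qed.

(** * Thresholds *)

Lemma sqdist_nonneg d x y : 0 <= sqdist d x y.
Proof. rewrite sqdist_dot. apply dot_sq_nonneg. Qed.

Lemma dist2_le d x y z w : dist2 d x y <= dist2 d z w <-> sqdist d x y <= sqdist d z w.
Proof.
  split; intros H; [|apply sqrt_le_1_alt; auto].
  apply sqrt_le_0; auto using sqdist_nonneg.
Qed.

Lemma dist2_le_radius d x y e :
  0 < e -> dist2 d x y <= e <-> sqdist d x y <= e * e.
Proof.
  intros He. unfold dist2. split; intros H.
  - rewrite <- (sqrt_sqrt (sqdist d x y)) by apply sqdist_nonneg.
    apply Rmult_le_compat; auto using sqrt_pos.
  - rewrite <- (sqrt_square e) by lra. apply sqrt_le_1_alt; auto.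
Qed.

(** A tie is the failure of both strict comparisons, the strict one being the only test on reals in
    the expression language. *)
Definition ahead (c : bool) (ds : nat -> R) (k j : nat) : bool :=
  if Nat.eqb k j then false
  else if Rlt_dec (ds k) (ds j) then true
  else if Rlt_dec (ds j) (ds k) then false else prio c k j.

Definition sqrank (c : bool) (n : nat) (ds : nat -> R) (j : nat) : nat :=
  S (countN n (fun k => ahead c ds k j)).

Definition with_target (rho : R) (ds : nat -> R) : nat -> R :=
  fun k => if Nat.eqb k 0 then rho else ds k.

(** The distances [rho] to the target are free parameters, not tied to a point, so that scores can
    be evaluated at a vector of thresholds. *)
Definition sqscore (c : bool) (n m : nat) (f : nat -> R) (Ds : nat -> nat -> R)
    (rho : nat -> R) (j : nat) : R :=
  sumR m (fun i => f (sqrank c n (with_target (rho i) (Ds i)) j)).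

Lemma countN_ext N p q :
  (forall k, (k < N)%nat -> p k = q k) -> countN N p = countN N q.
Proof. induction N; simpl; intros H; auto. rewrite IHN, H; auto. Qed.

Lemma countN_le N p q :
  (forall k, (k < N)%nat -> p k = true -> q k = true) -> (countN N p <= countN N q)%nat.
Proof.
  induction N as [|N IH]; simpl; intros H; auto.
  specialize (IH (fun k Hk => H k (Nat.lt_lt_succ_r _ _ Hk))).
  specialize (H N (Nat.lt_succ_diag_r N)).
  destruct (p N), (q N); lia.
Qed.

Lemma countN_bound N p : (countN N p <= N)%nat.
Proof. induction N; simpl; auto. destruct (p N); lia. Qed.

Lemma countN_lt N p j : (j < N)%nat -> p j = false -> (countN N p < N)%nat.
Proof.
  induction N as [|N IH]; intros Hj Hp; [lia|]. simpl.
  destruct (Nat.eq_dec j N) as [->|Hn].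
  - rewrite Hp. pose proof (countN_bound N p). lia.
  - specialize (IH ltac:(lia) Hp). destruct (p N); lia.
Qed.

Lemma sqrank_bounds c n ds j : (j < n)%nat -> (1 <= sqrank c n ds j <= n)%nat.
Proof.
  intros Hj. unfold sqrank. split; [lia|].
  apply (countN_lt n _ j Hj). unfold ahead. rewrite Nat.eqb_refl. auto.
Qed.

Lemma rank_sqrank c n d Cp v j :
  rank c n d Cp v j = sqrank c n (fun k => sqdist d v (Cp k)) j.
Proof.
  unfold rank, sqrank. f_equal. apply countN_ext. intros k Hk. unfold ahead.
  destruct (Nat.eqb k j); auto.
  pose proof (dist2_le d v (Cp k) v (Cp j)).
  pose proof (dist2_le d v (Cp j) v (Cp k)).
  destruct (Rlt_dec (dist2 d v (Cp k)) (dist2 d v (Cp j))),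
    (Rlt_dec (sqdist d v (Cp k)) (sqdist d v (Cp j))); auto; try (exfalso; lra).
  destruct (Req_EM_T (dist2 d v (Cp k)) (dist2 d v (Cp j))),
    (Rlt_dec (sqdist d v (Cp j)) (sqdist d v (Cp k))); auto; exfalso; lra.
Qed.

Lemma sqrank_ext c n ds ds' j :
  (j < n)%nat -> (forall k, (k < n)%nat -> ds k = ds' k) ->
  sqrank c n ds j = sqrank c n ds' j.
Proof.
  intros Hj H. unfold sqrank. f_equal. apply countN_ext. intros k Hk.
  unfold ahead. rewrite !H by auto. reflexivity.
Qed.

Lemma score_sqscore c n m d f C V ct j :
  (j < n)%nat ->
  score c n m d f (moved C ct) V j =
  sqscore c n m f (fun i k => sqdist d (V i) (C k)) (fun i => sqdist d (V i) ct) j.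
Proof.
  intros Hj. apply sumR_ext. intros i Hi. rewrite rank_sqrank. f_equal.
  apply sqrank_ext; auto. intros k Hk. unfold moved, with_target.
  destruct (Nat.eqb k 0); auto.
Qed.

Definition successful (c : bool) (n m : nat) (f : nat -> R) (Ds : nat -> nat -> R)
    (rho : nat -> R) : Prop :=
  if c then forall j, (j < n)%nat ->
    sqscore c n m f Ds rho j <= sqscore c n m f Ds rho 0
  else exists j, (0 < j < n)%nat /\
    sqscore c n m f Ds rho 0 <= sqscore c n m f Ds rho j.

(* Distance [a] to the target serves the adversary at least as well as [b]. *)
Definition as_good (c : bool) (n : nat) (ds : nat -> R) (a b : R) : Prop :=
  forall k, (0 < k < n)%nat ->
    if c then ds k < a -> ds k < b else ds k <= b -> ds k <= a.

(** Under the tie rule, candidate [k] precedes a target at distance [a] exactly when [ds k < a] in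
    the constructive case and [ds k <= a] in the destructive one; these are the tests in
    [as_good]. *)
Lemma sqrank_target_mono c n ds a b :
  as_good c n ds a b ->
  if c then (sqrank c n (with_target a ds) 0 <= sqrank c n (with_target b ds) 0)%nat
  else (sqrank c n (with_target b ds) 0 <= sqrank c n (with_target a ds) 0)%nat.
Proof.
  intros H.
  destruct c; apply le_n_S, countN_le; intros k Hk; unfold ahead, with_target;
    destruct (Nat.eqb_spec k 0); simpl; auto;
    specialize (H k ltac:(lia)); simpl in H.
  - destruct (Rlt_dec (ds k) a).
    + destruct (Rlt_dec (ds k) b); auto.
    + destruct (Rlt_dec a (ds k)); [discriminate|].
      destruct (Nat.eqb_spec k 0); simpl; [contradiction|discriminate].
  - destruct (Nat.eqb_spec k 0); [contradiction|]. simpl.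
    destruct (Rlt_dec (ds k) b), (Rlt_dec (ds k) a), (Rlt_dec b (ds k)),
      (Rlt_dec a (ds k)); auto; try discriminate; exfalso; lra.
Qed.

(** Among the comparisons that rank [j], only the one with the target depends on the distance of the
    target, so the rank of [j] moves against that of the target. *)
Lemma sqrank_other_mono c n ds a b j :
  as_good c n ds a b -> (0 < j < n)%nat ->
  if c then (sqrank c n (with_target b ds) j <= sqrank c n (with_target a ds) j)%nat
  else (sqrank c n (with_target a ds) j <= sqrank c n (with_target b ds) j)%nat.
Proof.
  intros H Hj. specialize (H j Hj).
  destruct c; apply le_n_S, countN_le; intros k Hk; unfold ahead, with_target;
    destruct (Nat.eqb_spec j 0); [lia| |lia|];
    (destruct (Nat.eqb_spec k j); [auto|]);
    (destruct (Nat.eqb_spec k 0) as [->|]; [|auto]); simpl.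
  - destruct (Rlt_dec a (ds j)), (Rlt_dec (ds j) a), (Rlt_dec b (ds j)),
      (Rlt_dec (ds j) b); auto; try discriminate; intros; exfalso; lra.
  - destruct (Rlt_dec a (ds j)), (Rlt_dec (ds j) a), (Rlt_dec b (ds j)),
      (Rlt_dec (ds j) b); auto; try discriminate; intros; exfalso; lra.
Qed.

(** As [f] is non-increasing, the two monotonicity lemmas on ranks shift the score of the target and
    the scores of the others in opposite directions, both in favor of the adversary. *)
Lemma successful_mono c n m f Ds a b :
  (1 <= n)%nat ->
  (forall t t', (1 <= t)%nat -> (t <= t')%nat -> (t' <= n)%nat -> f t' <= f t) ->
  (forall i, (i < m)%nat -> as_good c n (Ds i) (a i) (b i)) ->
  successful c n m f Ds b -> successful c n m f Ds a.
Proof.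
  intros Hn Hf Hab.
  assert (Hf' : forall ds ds' j j', (j < n)%nat -> (j' < n)%nat ->
    (sqrank c n ds j <= sqrank c n ds' j')%nat ->
    f (sqrank c n ds' j') <= f (sqrank c n ds j)).
  { intros ds ds' j j' Hj Hj' Hle.
    apply Hf; auto; apply sqrank_bounds; auto. }
  destruct c; unfold successful.
  - intros H j Hj. destruct (Nat.eq_dec j 0) as [->|Hj0]; [apply Rle_refl|].
    apply Rle_trans with (sqscore true n m f Ds b j);
      [|apply Rle_trans with (sqscore true n m f Ds b 0); [auto|]];
      apply sumR_le; intros i Hi; apply Hf'; auto.
    + apply (sqrank_other_mono true); auto; lia.
    + apply (sqrank_target_mono true); auto.
  - intros (j & Hj & H). exists j; split; auto.
    apply Rle_trans with (sqscore false n m f Ds b 0);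
      [|apply Rle_trans with (sqscore false n m f Ds b j); [auto|]];
      apply sumR_le; intros i Hi; apply Hf'; auto; try lia.
    + apply (sqrank_target_mono false); auto.
    + apply (sqrank_other_mono false); auto.
Qed.

(** Index 0 belongs to the target, which cannot be its own threshold; it is reused to mean that the
    voter imposes nothing beyond [big]. *)
Definition threshold (big : R) (ds : nat -> R) (k : nat) : R :=
  if Nat.ltb 0 k then ds k else big.

(** Among [big] and the competing distances, take the smallest at or above [rho] in the constructive
    case and the largest at or below [rho] in the destructive one: between [rho] and this value no
    candidate is passed to the disadvantage of the adversary. The induction keeps the best index so
    far. *)
Lemma threshold_choice c n ds rho big :
  (1 <= n)%nat -> within c rho big ->
  exists k, (k < n)%nat /\ within c rho (threshold big ds k) /\
    as_good c n ds (threshold big ds k) rho.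
Proof.
  intros Hn Hbig. induction n as [|n IH]; [lia|].
  destruct (Nat.eq_dec n 0) as [->|Hn0].
  - exists 0%nat. split; [lia|split; auto]. intros k Hk; lia.
  - destruct IH as (k & Hk & Hw & Hg); [lia|].
    set (b := threshold big ds k) in *.
    assert (Hnew : threshold big ds n = ds n)
      by (unfold threshold; destruct (Nat.ltb_spec 0 n); [auto|lia]).
    destruct c; unfold within in *.
    + destruct (Rlt_dec (ds n) b) as [H1|H1]; [destruct (Rlt_dec (ds n) rho) as [H2|H2]|].
      * exists k. split; [lia|split; auto]. intros j Hj; fold b.
        destruct (Nat.eq_dec j n) as [->|]; auto. apply Hg; lia.
      * exists n. rewrite Hnew. split; [lia|split; [lra|]]. intros j Hj H.
        destruct (Nat.eq_dec j n) as [->|]; [lra|]. apply Hg; [lia|lra].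
      * exists k. split; [lia|split; auto]. intros j Hj H; fold b in H.
        destruct (Nat.eq_dec j n) as [->|]; [lra|]. apply Hg; [lia|lra].
    + destruct (Rlt_dec b (ds n)) as [H1|H1]; [destruct (Rlt_dec rho (ds n)) as [H2|H2]|].
      * exists k. split; [lia|split; auto]. intros j Hj H; fold b.
        destruct (Nat.eq_dec j n) as [->|]; [lra|]. apply Hg; [lia|lra].
      * exists n. rewrite Hnew. split; [lia|split; [lra|]]. intros j Hj H.
        destruct (Nat.eq_dec j n) as [->|]; [lra|].
        specialize (Hg j ltac:(lia) H). lra.
      * exists k. split; [lia|split; auto]. intros j Hj H; fold b.
        destruct (Nat.eq_dec j n) as [->|]; [lra|]. apply Hg; [lia|lra].
Qed.

(** Choice over finitely many indices, by induction; it collects the thresholds of the voters, and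
    later the expressions for the various dimensions. *)
Lemma finite_choice (A : Type) (a0 : A) m (P : nat -> A -> Prop) :
  (forall i, (i < m)%nat -> exists k, P i k) ->
  exists g : nat -> A, forall i, (i < m)%nat -> P i (g i).
Proof.
  induction m as [|m IH]; intros H; [exists (fun _ => a0); intros; lia|].
  destruct IH as [g Hg]; [auto|]. destruct (H m) as [k Hk]; [lia|].
  exists (fun i => if Nat.eqb i m then k else g i). intros i Hi.
  destruct (Nat.eqb_spec i m) as [->|]; [auto|apply Hg; lia].
Qed.

Definition possible (c : bool) (n m d : nat) (eps : R) (f : nat -> R)
    (C V : nat -> nat -> R) : Prop :=
  if c then constructive_possible n m d eps f C V
  else destructive_possible n m d eps f C V.

Lemma possible_sqdist c n m d eps f C V :
  valid_instance n m d eps f C V ->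
  possible c n m d eps f C V <->
  exists ct, sqdist d ct (C 0%nat) <= eps * eps /\
    successful c n m f (fun i k => sqdist d (V i) (C k)) (fun i => sqdist d (V i) ct).
Proof.
  intros (Hn & He & _). destruct c; simpl.
  - split; intros (ct & H1 & H2); exists ct; (split; [apply dist2_le_radius; auto|]);
      intros j Hj; specialize (H2 j Hj); rewrite !score_sqscore in * by lia; auto.
  - split; intros (ct & H1 & j & Hj & H2); exists ct;
      (split; [apply dist2_le_radius; auto|]); exists j;
      rewrite !score_sqscore in * by lia; auto.
Qed.

(** One direction replaces actual distances by thresholds that are as good. For the other, a point
    respecting the thresholds is as good as the thresholds themselves, so success at the thresholds
    carries over to it. *)
Lemma possible_thresholds c n m d eps f C V (big : nat -> R) :
  valid_instance n m d eps f C V ->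
  (forall ct i, (i < m)%nat -> sqdist d ct (C 0%nat) <= eps * eps ->
     within c (sqdist d (V i) ct) (big i)) ->
  let B kappa i := threshold (big i) (fun k => sqdist d (V i) (C k)) (kappa i) in
  possible c n m d eps f C V <->
  exists kappa : nat -> nat, (forall i, (i < m)%nat -> (kappa i < n)%nat) /\
    successful c n m f (fun i k => sqdist d (V i) (C k)) (B kappa) /\
    exists ct, sqdist d ct (C 0%nat) <= eps * eps /\
      forall i, (i < m)%nat -> within c (sqdist d (V i) ct) (B kappa i).
Proof.
  intros Hv Hbig B. rewrite possible_sqdist by auto.
  destruct Hv as (Hn & He & Hf & _). split.
  - intros (ct & H1 & H2).
    destruct (finite_choice nat 0%nat m (fun i k => (k < n)%nat /\
      within c (sqdist d (V i) ct) (threshold (big i) (fun k => sqdist d (V i) (C k)) k) /\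
      as_good c n (fun k => sqdist d (V i) (C k))
        (threshold (big i) (fun k => sqdist d (V i) (C k)) k) (sqdist d (V i) ct)))
      as [kappa Hk].
    { intros i Hi. apply threshold_choice; auto. }
    exists kappa. split; [|split].
    + intros i Hi; apply Hk; auto.
    + apply successful_mono with (fun i => sqdist d (V i) ct); auto.
      intros i Hi; apply Hk; auto.
    + exists ct. split; auto. intros i Hi; apply Hk; auto.
  - intros (kappa & Hk & Hs & ct & H1 & H2). exists ct. split; auto.
    apply successful_mono with (B kappa); auto.
    intros i Hi k Hkn. specialize (H2 i Hi). unfold within in H2.
    destruct c; intros; lra.
Qed.

(** * The decision algorithm as an expression *)

(* Program variables: 0 is a coordinate, 1 a dummy summed over to multiply by
   the dimension, 2 and 3 are candidates, and 4 + i is the candidate whose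
   distance to voter i serves as threshold.  A voter i is the point n + i. *)
Definition coordE (p : nexp) : rexp :=
  RLd (NPlus (NPlus (NC 1) (NLim false)) (NPlus (NSum 1 true p) (NVar 0))).
Definition dotE (p q p' q' : nexp) : rexp :=
  RSum 0 true (RTimes (RMinus (coordE p) (coordE q)) (RMinus (coordE p') (coordE q'))).
Definition voterE (i : nat) : nexp := NPlus (NLim false) (NC i).
Definition sqdistE (i : nat) (k : nexp) : rexp := dotE (voterE i) k (voterE i) k.
Definition gramE (i j : nat) : rexp := dotE (voterE i) (NC 0) (voterE j) (NC 0).
Definition eps2E : rexp := RTimes (RLd (NC 0)) (RLd (NC 0)).
(** A bound that every reachable point satisfies: [2 * (|v_i - c_1|^2 + eps^2)] from above or 0 from
    below, according to the direction of the constraint. *)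
Definition bigE (c : bool) (i : nat) : rexp :=
  if c then RTimes (RC 2 1) (RPlus (gramE i i) eps2E) else RC 0 1.
Definition thresholdE (c : bool) (i : nat) : rexp :=
  RIf (NVar (4 + i)) (sqdistE i (NVar (4 + i))) (bigE c i).
Definition dsE (c : bool) (i : nat) (k : nexp) : rexp :=
  RIf k (sqdistE i k) (thresholdE c i).
Definition notE (a : nexp) : nexp := NIf a (NC 0) (NC 1).
Definition andE (a b : nexp) : nexp := NIf a b (NC 0).
Definition orE (a b : nexp) : nexp := NIf a (NC 1) b.
Definition prioE (c : bool) (k j : nexp) : nexp :=
  if c then orE (notE k) (andE j (NLt k j)) else andE k (orE (notE j) (NLt k j)).
Definition aheadE (c : bool) (i : nat) (k j : nexp) : nexp :=
  NIf (andE (notE (NLt k j)) (notE (NLt j k))) (NC 0)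
    (NIf (RLt (dsE c i k) (dsE c i j)) (NC 1)
      (NIf (RLt (dsE c i j) (dsE c i k)) (NC 0) (prioE c k j))).
Definition rankE (c : bool) (i : nat) (j : nexp) : nexp :=
  NPlus (NC 1) (NSum 2 false (aheadE c i (NVar 2) j)).
(** Unrolled over the voters, whose number is fixed. The value [f t] is the input at position [t],
    so the rank itself is the address. *)
Fixpoint scoreE (c : bool) (m : nat) (j : nexp) : rexp :=
  match m with
  | O => RC 0 1
  | S i => RPlus (scoreE c i j) (RLd (rankE c i j))
  end.
Definition successfulE (c : bool) (m : nat) : nexp :=
  if c then notE (NSum 3 false (RLt (scoreE c m (NC 0)) (scoreE c m (NVar 3))))
  else NSum 3 false
    (andE (NVar 3) (notE (RLt (scoreE c m (NVar 3)) (scoreE c m (NC 0))))).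
(** A chain of tests on [d] that selects the entry of dimension [min d (D + k)]. *)
Fixpoint by_dimensionE (FE : nat -> nexp) (k D : nat) : nexp :=
  match k with
  | O => FE D
  | S k => NIf (NLt (NLim true) (NC (S D))) (FE D) (by_dimensionE FE k (S D))
  end.
(** Each threshold index has a loop over the candidates of its own; these nested sums are what puts
    [m] in the exponent of the running time. *)
Fixpoint existsE (m : nat) (b : nexp) : nexp :=
  match m with
  | O => b
  | S i => existsE i (NSum (4 + i) false b)
  end.
Definition algorithmE (c : bool) (m : nat) (FE : nat -> nexp) : nexp :=
  existsE m (andE (successfulE c m) (by_dimensionE FE (S m) 0)).

Lemma sumN_pos N g : (0 < sumN N g)%nat <-> exists k, (k < N)%nat /\ (0 < g k)%nat.
Proof.
  induction N as [|N IH]; simpl; [split; [lia|intros (k & Hk & _); lia]|].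
  split.
  - intros H. destruct (Nat.eq_dec (g N) 0) as [E|E].
    + destruct IH as [IH _]. destruct IH as (k & Hk & H'); [lia|]. exists k; auto.
    + exists N; lia.
  - intros (k & Hk & H). destruct (Nat.eq_dec k N) as [->|]; [lia|].
    assert (0 < sumN N g)%nat by (apply IH; exists k; split; auto; lia). lia.
Qed.

Lemma sumN_const N a : sumN N (fun _ => a) = (N * a)%nat.
Proof. induction N; simpl; auto. rewrite IHN; lia. Qed.

Lemma sumN_count N g (p : nat -> bool) :
  (forall k, (k < N)%nat -> g k = if p k then 1%nat else 0%nat) -> sumN N g = countN N p.
Proof. induction N; simpl; intros H; auto. rewrite IHN, H; auto. Qed.

(** * Correctness of the expressions on a given instance *)

Section Instance.
Variables (c : bool) (n m d : nat) (eps : R) (f : nat -> R) (C V : nat -> nat -> R).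
Variable M : nat -> R.
Hypothesis Hn : (1 <= n)%nat.
Hypothesis HM : forall a, (a < input_length n m d)%nat ->
  M a = init_rmem n m d eps f C V a.

Definition standard (ix : nat -> nat) : Prop := ix 0%nat = n /\ ix 2%nat = d.

Lemma standard_upd ix x k : standard ix -> standard (updN ix (var_reg x) k).
Proof. intros [H1 H2]. split; rewrite updN_diff by (unfold var_reg; lia); auto. Qed.

Definition point (p : nat) : nat -> R := if Nat.ltb p n then C p else V (p - n)%nat.

(** [coordE] evaluates [p] with variables 0 and 1 overwritten, so the value must not depend on
    them. *)
Definition denotes (ix : nat -> nat) (p : nexp) (P : nat) : Prop :=
  (P < n + m)%nat /\
  forall k0 k1, denN p (updN (updN ix (var_reg 0) k0) (var_reg 1) k1) M = P.

(** Voters directly follow the candidates in the input, so numbering voter [i] as point [n + i]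
    gives one address formula for both. *)
Lemma input_coordinate P k :
  (P < n + m)%nat -> (k < d)%nat -> M (1 + n + (d * P + k))%nat = point P k.
Proof.
  intros HP Hk. rewrite HM by (unfold input_length; nia).
  unfold init_rmem, point.
  destruct (Nat.eqb_spec (1 + n + (d * P + k)) 0); [lia|].
  destruct (Nat.leb_spec (1 + n + (d * P + k)) n); [lia|].
  destruct (Nat.ltb_spec P n).
  - destruct (Nat.ltb_spec (1 + n + (d * P + k)) (1 + n + n * d)); [|nia].
    replace (1 + n + (d * P + k) - 1 - n)%nat with (P * d + k)%nat by lia.
    rewrite Nat.div_add_l, Nat.div_small by lia.
    rewrite (Nat.add_comm (_ * _)), Nat.Div0.mod_add, Nat.mod_small by lia.
    f_equal; lia.
  - destruct (Nat.ltb_spec (1 + n + (d * P + k)) (1 + n + n * d)); [nia|].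
    destruct (Nat.ltb_spec (1 + n + (d * P + k)) (1 + n + n * d + m * d)); [|nia].
    replace (1 + n + (d * P + k) - 1 - n - n * d)%nat with ((P - n) * d + k)%nat by nia.
    rewrite Nat.div_add_l, Nat.div_small by lia.
    rewrite (Nat.add_comm (_ * _)), Nat.Div0.mod_add, Nat.mod_small by lia.
    f_equal; lia.
Qed.

Lemma coordE_den ix p P k :
  standard ix -> denotes ix p P -> (k < d)%nat ->
  denR (coordE p) (updN ix (var_reg 0) k) M = point P k.
Proof.
  intros [H0 H2] [HP Hp] Hk. unfold coordE. cbn [denR denN].
  change (updN ix (var_reg 0) k (lim_reg true)) with (ix 2%nat).
  change (updN ix (var_reg 0) k (lim_reg false)) with (ix 0%nat).
  rewrite (sumN_ext _ _ (fun _ => P)) by (intros; apply Hp).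
  rewrite sumN_const, H0, H2, updN_same.
  apply (input_coordinate P k HP Hk).
Qed.

Lemma dotE_den ix p q p' q' P Q P' Q' :
  standard ix -> denotes ix p P -> denotes ix q Q -> denotes ix p' P' ->
  denotes ix q' Q' ->
  denR (dotE p q p' q') ix M =
  dot d (vsub (point P) (point Q)) (vsub (point P') (point Q')).
Proof.
  intros H Hp Hq Hp' Hq'. unfold dotE. cbn [denR].
  change (ix (lim_reg true)) with (ix 2%nat). rewrite (proj2 H).
  apply sumR_ext. intros k Hk. unfold vsub.
  rewrite (coordE_den ix p P), (coordE_den ix q Q), (coordE_den ix p' P'),
    (coordE_den ix q' Q'); auto.
Qed.

Lemma denotes_const ix k : (k < n)%nat -> denotes ix (NC k) k.
Proof. split; [lia|reflexivity]. Qed.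

Lemma denotes_var ix x : (ix (var_reg (2 + x)) < n)%nat ->
  denotes ix (NVar (2 + x)) (ix (var_reg (2 + x))).
Proof. split; [lia|reflexivity]. Qed.

Lemma denotes_voter ix i : standard ix -> (i < m)%nat -> denotes ix (voterE i) (n + i).
Proof.
  intros [H _] Hi. split; [lia|]. intros. simpl.
  change (ix 0 + i = n + i)%nat. rewrite H; auto.
Qed.

Lemma point_candidate k : (k < n)%nat -> point k = C k.
Proof. intros H. unfold point. apply Nat.ltb_lt in H. rewrite H; auto. Qed.

Lemma point_voter i : point (n + i) = V i.
Proof.
  unfold point. destruct (Nat.ltb_spec (n + i) n); [lia|]. f_equal; lia.
Qed.

Lemma sqdistE_den ix i p P :
  standard ix -> (i < m)%nat -> (P < n)%nat -> denotes ix p P ->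
  denR (sqdistE i p) ix M = sqdist d (V i) (C P).
Proof.
  intros H Hi HP Hp. unfold sqdistE.
  rewrite (dotE_den ix _ _ _ _ (n + i) P (n + i) P) by auto using denotes_voter.
  rewrite point_voter, point_candidate, <- sqdist_dot by auto. auto.
Qed.

Lemma gramE_den ix i j :
  standard ix -> (i < m)%nat -> (j < m)%nat ->
  denR (gramE i j) ix M = dot d (vsub (V i) (C 0%nat)) (vsub (V j) (C 0%nat)).
Proof.
  intros H Hi Hj. unfold gramE.
  rewrite (dotE_den ix _ _ _ _ (n + i) 0 (n + j) 0)
    by (auto using denotes_voter; apply denotes_const; lia).
  rewrite !point_voter, point_candidate by lia. auto.
Qed.

Lemma eps2E_den ix : denR eps2E ix M = eps * eps.
Proof. simpl. rewrite HM by (unfold input_length; lia). reflexivity. Qed.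

Definition big (i : nat) : R :=
  if c then 2 * (dot d (vsub (V i) (C 0%nat)) (vsub (V i) (C 0%nat)) + eps * eps) else 0.

Lemma bigE_den ix i : standard ix -> (i < m)%nat -> denR (bigE c i) ix M = big i.
Proof.
  intros H Hi. unfold bigE, big. destruct c; cbn [denR].
  - rewrite gramE_den, eps2E_den by auto. field.
  - field.
Qed.

Lemma big_within ct i :
  (i < m)%nat -> sqdist d ct (C 0%nat) <= eps * eps ->
  within c (sqdist d (V i) ct) (big i).
Proof.
  intros Hi H. unfold within, big. destruct c; [|apply sqdist_nonneg].
  (* parallelogram law: [|a - b|^2 <= 2 |a|^2 + 2 |b|^2] *)
  set (a := vsub (V i) (C 0%nat)). rewrite sqdist_dot in *.
  set (b := vsub ct (C 0%nat)) in *.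
  assert (E : dot d (vsub (V i) ct) (vsub (V i) ct) = dot d (vsub a b) (vsub a b)).
  { apply dot_ext; intros; unfold a, b, vsub; ring. }
  pose proof (dot_sq_nonneg d (fun k => a k + 1 * b k)) as Hs.
  rewrite dot_linear, !(dot_comm d _ (fun k => a k + 1 * b k)), !dot_linear,
    (dot_comm d b a) in Hs.
  rewrite E, dot_vsub_sq. lra.
Qed.

Definition thresholds (kappa : nat -> nat) (i : nat) : R :=
  threshold (big i) (fun k => sqdist d (V i) (C k)) (kappa i).

Definition kappa_of (ix : nat -> nat) (i : nat) : nat := ix (var_reg (4 + i)).

Definition good_env (ix : nat -> nat) : Prop :=
  standard ix /\ forall i, (i < m)%nat -> (kappa_of ix i < n)%nat.

Lemma good_env_upd ix x k : (x < 4)%nat -> good_env ix ->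
  good_env (updN ix (var_reg x) k) /\
  kappa_of (updN ix (var_reg x) k) = kappa_of ix.
Proof.
  intros Hx [H1 H2].
  assert (E : forall i, kappa_of (updN ix (var_reg x) k) i = kappa_of ix i).
  { intros i. unfold kappa_of. apply updN_diff. unfold var_reg; lia. }
  split; [split|].
  - apply standard_upd; auto.
  - intros i Hi. rewrite E; auto.
  - unfold kappa_of, updN, var_reg. do 4 (destruct x as [|x]; [reflexivity|]). lia.
Qed.

Lemma thresholdE_den ix i :
  good_env ix -> (i < m)%nat ->
  denR (thresholdE c i) ix M = thresholds (kappa_of ix) i.
Proof.
  intros [H Hk] Hi. specialize (Hk i Hi).
  unfold thresholdE, thresholds, threshold. cbn [denR denN].
  fold (kappa_of ix i). rewrite bigE_den by auto.
  rewrite (sqdistE_den ix i _ (kappa_of ix i)); auto.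
  apply (denotes_var ix (2 + i)); auto.
Qed.

Lemma dsE_den ix i p P :
  good_env ix -> (i < m)%nat -> (P < n)%nat -> denotes ix p P -> denN p ix M = P ->
  denR (dsE c i p) ix M =
  with_target (thresholds (kappa_of ix) i) (fun k => sqdist d (V i) (C k)) P.
Proof.
  intros H Hi HP Hp E. unfold dsE, with_target. cbn [denR]. rewrite E.
  rewrite (sqdistE_den ix i p P), thresholdE_den by (auto; apply H).
  destruct P; reflexivity.
Qed.

Definition bool_nat (b : bool) : nat := if b then 1 else 0.

Lemma aheadE_den ix i p P q Q :
  good_env ix -> (i < m)%nat -> (P < n)%nat -> (Q < n)%nat ->
  denotes ix p P -> denN p ix M = P -> denotes ix q Q -> denN q ix M = Q ->
  denN (aheadE c i p q) ix M =
  bool_nat (ahead c (with_target (thresholds (kappa_of ix) i)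
                       (fun k => sqdist d (V i) (C k))) P Q).
Proof.
  intros H Hi HP HQ Hp Ep Hq Eq. unfold aheadE, ahead, andE, notE.
  assert (Hprio : denN (prioE c p q) ix M = bool_nat (prio c P Q)).
  { unfold prioE, prio, andE, orE, notE. destruct c; cbn [denN]; rewrite Ep, Eq;
      destruct P, Q; simpl; try reflexivity;
      match goal with |- context [Nat.ltb ?a ?b] => destruct (Nat.ltb a b) end;
      reflexivity. }
  cbn [denN]. rewrite Hprio, Ep, Eq, (dsE_den ix i p P), (dsE_den ix i q Q) by auto.
  set (ds := with_target _ _).
  destruct (Nat.ltb_spec P Q), (Nat.ltb_spec Q P), (Nat.eqb_spec P Q);
    try lia; simpl; destruct (Rlt_dec (ds P) (ds Q)); simpl; auto;
    destruct (Rlt_dec (ds Q) (ds P)); simpl; auto.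
Qed.

Lemma rankE_den ix i q Q :
  good_env ix -> (i < m)%nat -> (Q < n)%nat ->
  (forall k, denotes (updN ix (var_reg 2) k) q Q) ->
  (forall k, denN q (updN ix (var_reg 2) k) M = Q) ->
  denN (rankE c i q) ix M =
  sqrank c n (with_target (thresholds (kappa_of ix) i)
                (fun k => sqdist d (V i) (C k))) Q.
Proof.
  intros H Hi HQ Hq Eq. unfold sqrank.
  change (denN (rankE c i q) ix M) with
    (S (sumN (ix 0%nat) (fun k => denN (aheadE c i (NVar 2) q) (updN ix (var_reg 2) k) M))).
  f_equal. rewrite (proj1 (proj1 H)).
  apply sumN_count. intros k Hk. cbv beta.
  destruct (good_env_upd ix 2 k ltac:(lia) H) as [H' E].
  rewrite (aheadE_den _ i (NVar 2) k q Q); auto.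
  split; [lia|reflexivity].
Qed.

Lemma scoreE_den ix q Q : forall m', (m' <= m)%nat ->
  good_env ix -> (Q < n)%nat ->
  (forall k, denotes (updN ix (var_reg 2) k) q Q) ->
  (forall k, denN q (updN ix (var_reg 2) k) M = Q) ->
  denR (scoreE c m' q) ix M =
  sqscore c n m' f (fun i k => sqdist d (V i) (C k)) (thresholds (kappa_of ix)) Q.
Proof.
  intros m' Hm' H HQ Hq Eq. unfold sqscore.
  induction m' as [|i IH]; [simpl; field|].
  cbn [scoreE denR sumR]. rewrite IH by lia. f_equal.
  rewrite (rankE_den ix i q Q) by (auto; lia).
  (* A rank lies between 1 and [n], exactly the addresses at which the input stores [f]. *)
  match goal with |- M ?r = _ => assert (Hr : (1 <= r <= n)%nat)
    by (apply sqrank_bounds; auto) end.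
  rewrite HM by (unfold input_length; lia). unfold init_rmem.
  destruct (Nat.eqb_spec (sqrank c n (with_target (thresholds (kappa_of ix) i)
    (fun k => sqdist d (V i) (C k))) Q) 0); [lia|].
  rewrite (proj2 (Nat.leb_le _ _)) by lia. reflexivity.
Qed.

Lemma successfulE_den ix :
  good_env ix ->
  (0 < denN (successfulE c m) ix M)%nat <->
  successful c n m f (fun i k => sqdist d (V i) (C k)) (thresholds (kappa_of ix)).
Proof.
  intros H. unfold successfulE, successful.
  assert (S0 : forall k, denR (scoreE c m (NC 0)) (updN ix (var_reg 3) k) M =
    sqscore c n m f (fun i k => sqdist d (V i) (C k)) (thresholds (kappa_of ix)) 0).
  { intros k. destruct (good_env_upd ix 3 k ltac:(lia) H) as [H' E].
    rewrite (scoreE_den _ _ 0%nat), E; auto. intros; apply denotes_const; lia. }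
  assert (S3 : forall k, (k < n)%nat ->
    denR (scoreE c m (NVar 3)) (updN ix (var_reg 3) k) M =
    sqscore c n m f (fun i k => sqdist d (V i) (C k)) (thresholds (kappa_of ix)) k).
  { intros k Hk. destruct (good_env_upd ix 3 k ltac:(lia) H) as [H' E].
    rewrite (scoreE_den _ _ k), E; auto. intros j; split; [lia|reflexivity]. }
  pose proof (proj1 (proj1 H)) as Hix.
  revert S0 S3. generalize (sqscore c n m f (fun i k => sqdist d (V i) (C k))
    (thresholds (kappa_of ix))). intros sc S0 S3.
  destruct c; unfold notE, andE; cbn [denN];
    change (ix (lim_reg false)) with (ix 0%nat); rewrite Hix.
  - match goal with |- (0 < if Nat.ltb 0 ?s then _ else _)%nat <-> _ =>
      assert (HS : (0 < s)%nat <-> exists k, (k < n)%nat /\ sc 0%nat < sc k) end.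
    { rewrite sumN_pos. split; intros (k & Hk & H'); exists k; (split; [auto|]).
      - rewrite S0, S3 in H' by auto.
        destruct (Rlt_dec (sc 0%nat) (sc k)); [auto|lia].
      - rewrite S0, S3 by auto.
        destruct (Rlt_dec (sc 0%nat) (sc k)); [lia|contradiction]. }
    destruct (Nat.ltb_spec 0 (sumN n (fun k => if Rlt_dec
        (denR (scoreE true m (NC 0)) (updN ix (var_reg 3) k) M)
        (denR (scoreE true m (NVar 3)) (updN ix (var_reg 3) k) M) then 1%nat else 0%nat)))
      as [Hlt|Hge].
    + split; [lia|]. intros Hall. apply HS in Hlt as (k & Hk & H').
      specialize (Hall k Hk). lra.
    + split; [|lia]. intros _ j Hj. apply Rnot_lt_le. intros H'.
      apply (proj1 (Nat.le_ngt _ _) Hge). apply HS. exists j; auto.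
  - rewrite sumN_pos. split.
    + intros (k & Hk & H'). rewrite S0, S3, updN_same in H' by auto.
      exists k. destruct (Nat.ltb_spec 0 k); [|lia]. split; [lia|].
      destruct (Rlt_dec (sc k) (sc 0%nat)); simpl in H'; [lia|lra].
    + intros (k & Hk & H'). exists k. split; [lia|].
      rewrite S0, S3, updN_same by lia. rewrite (proj2 (Nat.ltb_lt 0 k)) by lia.
      destruct (Rlt_dec (sc k) (sc 0%nat)); simpl; [lra|lia].
Qed.

End Instance.

Lemma by_dimensionE_den FE ix M : forall k D, (D <= ix 2)%nat ->
  denN (by_dimensionE FE k D) ix M = denN (FE (Nat.min (ix 2%nat) (D + k))) ix M.
Proof.
  induction k as [|k IH]; intros D HD; cbn [by_dimensionE denN].
  - do 2 f_equal. lia.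
  - change (ix (lim_reg true)) with (ix 2%nat).
    destruct (Nat.ltb_spec (ix 2%nat) (S D)).
    + simpl. do 2 f_equal. lia.
    + simpl. rewrite IH by auto. do 2 f_equal. lia.
Qed.

Fixpoint assign (m : nat) (kappa : nat -> nat) (ix : nat -> nat) : nat -> nat :=
  match m with
  | O => ix
  | S i => updN (assign i kappa ix) (var_reg (4 + i)) (kappa i)
  end.

Lemma assign_ext m kappa kappa' ix :
  (forall i, (i < m)%nat -> kappa i = kappa' i) -> assign m kappa ix = assign m kappa' ix.
Proof. induction m; simpl; intros H; auto. rewrite IHm, H; auto. Qed.

(** Register 8 is that of the first threshold variable: 4 reserved registers precede the program
    variables, of which the first 4 are auxiliary. *)
Lemma assign_low m kappa ix k : (k < 8)%nat -> assign m kappa ix k = ix k.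
Proof.
  intros Hk. induction m; simpl; auto. rewrite updN_diff by (unfold var_reg; lia). auto.
Qed.

Lemma assign_var m kappa ix i : (i < m)%nat -> assign m kappa ix (var_reg (4 + i)) = kappa i.
Proof.
  induction m as [|m IH]; intros Hi; [lia|]. simpl assign.
  destruct (Nat.eq_dec i m) as [->|]; [apply updN_same|].
  rewrite updN_diff by (unfold var_reg; lia). apply IH; lia.
Qed.

Lemma existsE_den m ix M : forall b,
  (0 < denN (existsE m b) ix M)%nat <->
  exists kappa, (forall i, (i < m)%nat -> (kappa i < ix 0)%nat) /\
    (0 < denN b (assign m kappa ix) M)%nat.
Proof.
  induction m as [|m IH]; intros b; cbn [existsE assign].
  - split; [intros H; exists (fun _ => 0%nat); split; auto; lia|intros (? & _ & H); auto].
  - rewrite IH. split.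
    + intros (kappa & Hk & H). cbn [denN] in H. apply sumN_pos in H as (k & Hlt & H).
      change (lim_reg false) with 0%nat in Hlt. rewrite assign_low in Hlt by lia.
      exists (fun i => if Nat.eqb i m then k else kappa i). split.
      * intros i Hi. destruct (Nat.eqb_spec i m); auto. apply Hk; lia.
      * rewrite Nat.eqb_refl, (assign_ext m _ kappa); auto.
        intros i Hi. destruct (Nat.eqb_spec i m); auto; lia.
    + intros (kappa & Hk & H). exists kappa. split; [auto|].
      cbn [denN]. apply sumN_pos. exists (kappa m).
      change (lim_reg false) with 0%nat. rewrite assign_low by lia. auto.
Qed.

Lemma ltb0_notE a ix M :
  Nat.ltb 0 (denN (notE a) ix M) = negb (Nat.ltb 0 (denN a ix M)).
Proof. unfold notE; cbn [denN]. destruct (Nat.ltb 0 (denN a ix M)); reflexivity. Qed.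

Lemma ltb0_andE a b ix M :
  Nat.ltb 0 (denN (andE a b) ix M) =
  (Nat.ltb 0 (denN a ix M) && Nat.ltb 0 (denN b ix M))%bool.
Proof. unfold andE; cbn [denN]. destruct (Nat.ltb 0 (denN a ix M)); reflexivity. Qed.

Lemma ltb0_orE a b ix M :
  Nat.ltb 0 (denN (orE a b) ix M) =
  (Nat.ltb 0 (denN a ix M) || Nat.ltb 0 (denN b ix M))%bool.
Proof. unfold orE; cbn [denN]. destruct (Nat.ltb 0 (denN a ix M)); reflexivity. Qed.

Lemma ltb0_RLt a b ix M :
  Nat.ltb 0 (denN (RLt a b) ix M) = true <-> Rlt (denR a ix M) (denR b ix M).
Proof. cbn [denN]. destruct (Rlt_dec _ _); simpl; split; auto; discriminate. Qed.

(** All that is left open is a family [FE] of feasibility tests, for the dimensions up to [m + 1]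
    that [min d (S m)] can take. *)
Lemma algorithmE_correct c m (FE : nat -> nexp) :
  (forall D, (D < S (S m))%nat -> forall ix M, (0 < denN (FE D) ix M)%nat <->
     feasible c m D (denR eps2E ix M) (fun i j => denR (gramE i j) ix M)
       (fun i => denR (thresholdE c i) ix M)) ->
  poly_decides_fixed_m m (fun n m d eps f C V => possible c n m d eps f C V).
Proof.
  intros HFE. apply (expression_decides m (algorithmE c m FE)).
  intros n d eps f C V Hv ix M H0 H2 HM.
  assert (Hn : (1 <= n)%nat) by apply Hv.
  rewrite (possible_thresholds c n m d eps f C V (big c d eps C V) Hv)
    by (intros; eapply big_within; eauto).
  unfold algorithmE. rewrite existsE_den, H0.
  assert (Hstep : forall kappa, (forall i, (i < m)%nat -> (kappa i < n)%nat) ->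
    (0 < denN (andE (successfulE c m) (by_dimensionE FE (S m) 0)) (assign m kappa ix) M)%nat <->
    successful c n m f (fun i k => sqdist d (V i) (C k)) (thresholds c d eps C V kappa) /\
    exists ct, sqdist d ct (C 0%nat) <= eps * eps /\
      forall i, (i < m)%nat -> within c (sqdist d (V i) ct) (thresholds c d eps C V kappa i)).
  2:{ split; intros (kappa & Hk & H); exists kappa; (split; [auto|]);
        apply (Hstep kappa Hk); exact H. }
  intros kappa Hk. set (ix' := assign m kappa ix).
  assert (Hkap : forall i, (i < m)%nat -> kappa_of ix' i = kappa i)
    by (intros; apply assign_var; auto).
  assert (Hg : good_env n m d ix').
  { split; [split; unfold ix'; rewrite assign_low by lia; auto|].
    intros i Hi. rewrite Hkap; auto. }
  (* [kappa_of ix'] and [kappa] agree only on the [m] voters, so thresholds and scores are compared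
     voter by voter. *)
  assert (HT : forall i, (i < m)%nat ->
    thresholds c d eps C V (kappa_of ix') i = thresholds c d eps C V kappa i)
    by (intros i Hi; unfold thresholds; rewrite Hkap; auto).
  assert (HS : (0 < denN (successfulE c m) ix' M)%nat <->
    successful c n m f (fun i k => sqdist d (V i) (C k)) (thresholds c d eps C V kappa)).
  { rewrite (successfulE_den c n m d eps f C V M Hn HM ix' Hg).
    assert (E : forall j, sqscore c n m f (fun i k => sqdist d (V i) (C k))
        (thresholds c d eps C V (kappa_of ix')) j =
      sqscore c n m f (fun i k => sqdist d (V i) (C k)) (thresholds c d eps C V kappa) j).
    { intros j. apply sumR_ext. intros i Hi. rewrite HT; auto. }
    unfold successful. destruct c.
    - split; intros H j Hj; specialize (H j Hj); rewrite ?E in *; auto.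
    - split; intros (j & Hj & H); exists j; rewrite ?E in *; auto. }
  assert (HF : (0 < denN (by_dimensionE FE (S m) 0) ix' M)%nat <->
    exists ct, sqdist d ct (C 0%nat) <= eps * eps /\
      forall i, (i < m)%nat -> within c (sqdist d (V i) ct) (thresholds c d eps C V kappa i)).
  { rewrite feasible_reduction, by_dimensionE_den, HFE by lia.
    rewrite (proj2 (proj1 Hg)), Nat.add_0_l.
    split; apply feasible_ext.
    - apply (eps2E_den n m d eps f C V M Hn HM).
    - intros i j Hi Hj. apply (gramE_den n m d eps f C V M Hn HM); auto. apply Hg.
    - intros i Hi. rewrite <- HT by auto.
      apply (thresholdE_den c n m d eps f C V M Hn HM); auto.
    - symmetry; apply (eps2E_den n m d eps f C V M Hn HM).
    - intros i j Hi Hj. symmetry; apply (gramE_den n m d eps f C V M Hn HM); auto.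
      apply Hg.
    - intros i Hi. rewrite <- HT by auto. symmetry.
      apply (thresholdE_den c n m d eps f C V M Hn HM); auto. }
  rewrite <- HS, <- HF. unfold andE. cbn [denN].
  destruct (Nat.ltb_spec 0 (denN (successfulE c m) ix' M)); simpl; lia.
Qed.

(** * The feasibility problem as a formula in one environment *)

(** Assigns a whole block of variables at once, to be matched with a block of existential
    quantifiers. *)
Definition override (lo cnt : nat) (w rho : nat -> R) : nat -> R :=
  fun k => if (Nat.leb lo k && Nat.ltb k (lo + cnt))%bool then w k else rho k.

(* Variables of the feasibility formula: 0 is the squared radius, then come the
   m * m Gram entries and the m bounds; the quantified coordinates start at
   [free_vars m], each point of the configuration occupying D of them and the
   sought point being the last one. *)
Definition gram_var (m i j : nat) : nat := (1 + (i * m + j))%nat.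
Definition bound_var (m i : nat) : nat := (1 + (m * m + i))%nat.
Definition free_vars (m : nat) : nat := (1 + (m * m + m))%nat.
Definition coord_var (m D i k : nat) : nat := (free_vars m + (i * D + k))%nat.

Lemma gram_var_lt m i j :
  (i < m)%nat -> (j < m)%nat -> (gram_var m i j < free_vars m)%nat.
Proof. unfold gram_var, free_vars; nia. Qed.

Lemma bound_var_lt m i : (i < m)%nat -> (bound_var m i < free_vars m)%nat.
Proof. unfold bound_var, free_vars; lia. Qed.

Lemma free_vars_pos m : (0 < free_vars m)%nat.
Proof. unfold free_vars; lia. Qed.

(** The quantifier-free part of the formula: the conditions of [feasible], with points and data all
    read from the single environment [rho]. *)
Definition configuration (c : bool) (m D : nat) (rho : nat -> R) : Prop :=
  let p i k := rho (coord_var m D i k) in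
  (forall i, (i < m)%nat -> forall j, (j < m)%nat ->
     dot D (p i) (p j) = rho (gram_var m i j)) /\
  dot D (p m) (p m) <= rho 0%nat /\
  forall i, (i < m)%nat ->
    within c (dot D (vsub (p m) (p i)) (vsub (p m) (p i))) (rho (bound_var m i)).

Lemma configuration_feasible c m D rho :
  (exists w, configuration c m D (override (free_vars m) (S m * D) w rho)) <->
  feasible c m D (rho 0%nat) (fun i j => rho (gram_var m i j))
    (fun i => rho (bound_var m i)).
Proof.
  assert (Hfree : forall w k, (k < free_vars m)%nat ->
    override (free_vars m) (S m * D) w rho k = rho k).
  { intros w k Hk. unfold override. destruct (Nat.leb_spec (free_vars m) k); [lia|auto]. }
  assert (Hcoord : forall w i k, (i < S m)%nat -> (k < D)%nat ->
    override (free_vars m) (S m * D) w rho (coord_var m D i k) = w (coord_var m D i k)).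
  { intros w i k Hi Hk. unfold override, coord_var.
    rewrite (proj2 (Nat.leb_le _ _)) by lia. rewrite (proj2 (Nat.ltb_lt _ _)) by nia.
    reflexivity. }
  pose proof (gram_var_lt m) as HG. pose proof (bound_var_lt m) as HB.
  pose proof (free_vars_pos m) as H0.
  split.
  - intros (w & H1 & H2 & H3).
    exists (fun i k => override (free_vars m) (S m * D) w rho (coord_var m D i k)),
      (fun k => override (free_vars m) (S m * D) w rho (coord_var m D m k)).
    split; [|split].
    + intros i j Hi Hj. rewrite H1, Hfree; auto.
    + rewrite Hfree in H2; auto.
    + intros i Hi. specialize (H3 i Hi). rewrite Hfree in H3; auto.
  - intros (u & y & H1 & H2 & H3).
    set (u' := fun i => if Nat.eqb i m then y else u i).
    (* Position [i * D + k] of the block is decoded by division by [D]; the sought point is stored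
       as number [m]. *)
    exists (fun k => u' ((k - free_vars m) / D)%nat ((k - free_vars m) mod D)%nat).
    set (w := fun k : nat => _).
    assert (Hw : forall i k, (i < S m)%nat -> (k < D)%nat ->
      override (free_vars m) (S m * D) w rho (coord_var m D i k) = u' i k).
    { intros i k Hi Hk. rewrite Hcoord by auto. unfold w, coord_var.
      replace (free_vars m + (i * D + k) - free_vars m)%nat with (i * D + k)%nat by lia.
      rewrite Nat.div_add_l, Nat.div_small by lia.
      rewrite (Nat.add_comm (i * D)), Nat.Div0.mod_add, Nat.mod_small by lia.
      f_equal; lia. }
    assert (Hm : u' m = y) by (unfold u'; rewrite Nat.eqb_refl; auto).
    assert (Hlt : forall i, (i < m)%nat -> u' i = u i)
      by (intros i Hi; unfold u'; destruct (Nat.eqb_spec i m); [lia|auto]).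
    split; [|split].
    + intros i Hi j Hj. rewrite Hfree by auto. rewrite <- H1 by auto.
      apply dot_ext; intros k Hk; rewrite Hw, Hlt by auto; auto.
    + rewrite Hfree by auto. rewrite (dot_ext D _ _ y y); auto;
        intros k Hk; rewrite Hw, Hm by auto; auto.
    + intros i Hi. rewrite Hfree by auto. specialize (H3 i Hi).
      rewrite (dot_ext D _ _ (vsub y (u i)) (vsub y (u i))); auto;
        intros k Hk; unfold vsub; rewrite !Hw, Hm, Hlt by auto; auto.
Qed.

Section FormulaInputs.
Variables (A : Type) (m : nat) (a : A) (G : nat -> nat -> A) (B : nat -> A).

(** Inverse of the numberings [gram_var] and [bound_var]: the datum for which a free variable of the
    formula stands. *)
Definition parameter (k : nat) : A :=
  if Nat.eqb k 0 then a
  else if Nat.ltb (k - 1) (m * m) then G ((k - 1) / m) ((k - 1) mod m)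
  else B (k - 1 - m * m)%nat.

Lemma parameter_gram i j : (i < m)%nat -> (j < m)%nat -> parameter (gram_var m i j) = G i j.
Proof.
  intros Hi Hj. unfold parameter, gram_var.
  replace (1 + (i * m + j) - 1)%nat with (i * m + j)%nat by lia.
  rewrite (proj2 (Nat.ltb_lt _ _)) by nia.
  rewrite Nat.div_add_l, Nat.div_small by lia.
  rewrite (Nat.add_comm (i * m)), Nat.Div0.mod_add, Nat.mod_small by lia.
  simpl. f_equal; lia.
Qed.

Lemma parameter_bound i : parameter (bound_var m i) = B i.
Proof.
  unfold parameter, bound_var.
  rewrite (proj2 (Nat.ltb_ge _ _)) by lia. simpl. f_equal; lia.
Qed.
End FormulaInputs.

(** * Quantifier elimination with rational constants *)

From mathcomp Require Import all_boot all_order all_algebra.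
From mathcomp Require Import mxtens ordered_qelim qe_rcf_th qe_rcf.
From mathcomp Require Import Rstruct.
Import Order.TTheory GRing.Theory Num.Theory.

Section RationalConstants.
Local Open Scope ring_scope.
Variable F : rcfType.

(** Machine constants are integers, so a formula can be compiled only if its constants are quotients
    of integers, while the elimination procedure admits any constant of [F]. *)
Definition is_rat (x : F) : Prop := exists q : rat, x = ratr q.

Lemma is_rat_int (z : int) : is_rat z%:~R.
Proof. by exists z%:~R; rewrite ratr_int. Qed.

Lemma is_rat_nat (n : nat) : is_rat n%:R.
Proof. by exists n%:R; rewrite ratr_nat. Qed.

Fixpoint term_rat (t : qe_rcf.term F) : Prop :=
  match t with
  | qe_rcf.Var _ | qe_rcf.NatConst _ => Logic.True
  | qe_rcf.Const c => is_rat c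
  | qe_rcf.Add u v | qe_rcf.Mul u v => term_rat u /\ term_rat v
  | qe_rcf.Opp u | qe_rcf.NatMul u _ | qe_rcf.Exp u _ => term_rat u
  end.

Fixpoint qf_rat (f : qe_rcf.formula F) : Prop :=
  match f with
  | qe_rcf.Bool _ => Logic.True
  | qe_rcf.Equal u v | qe_rcf.Lt u v | qe_rcf.Le u v =>
      term_rat u /\ term_rat v
  | qe_rcf.And f g | qe_rcf.Or f g | qe_rcf.Implies f g => qf_rat f /\ qf_rat g
  | qe_rcf.Not f => qf_rat f
  end.

Definition poly_rat : polyF F -> Prop := List.Forall term_rat.
Definition polys_rat : seq (polyF F) -> Prop := List.Forall poly_rat.

Lemma poly_rat_nil : poly_rat [::].
Proof. exact: List.Forall_nil. Qed.

Lemma poly_rat_cons a p : term_rat a -> poly_rat p -> poly_rat (a :: p).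
Proof. by constructor. Qed.

Lemma poly_rat_inv a p : poly_rat (a :: p) -> term_rat a /\ poly_rat p.
Proof. by move=> H; inversion H. Qed.

Lemma polys_rat_inv a p : polys_rat (a :: p) -> poly_rat a /\ polys_rat p.
Proof. by move=> H; inversion H. Qed.

Lemma is_rat0 : is_rat 0. Proof. exact: (is_rat_nat 0). Qed.
Lemma is_ratN1 : is_rat (-1).
Proof. by have := is_rat_int (-1); rewrite mulrN1z. Qed.

Lemma Const_rat c : is_rat c -> term_rat (qe_rcf.Const c).
Proof. by []. Qed.

Lemma NatConst_rat n : term_rat (qe_rcf.NatConst F n).
Proof. by []. Qed.

Lemma Const0_rat : term_rat (qe_rcf.Const 0).
Proof. exact: is_rat0. Qed.

Lemma ConstN1_rat : term_rat (qe_rcf.Const (-1)).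
Proof. exact: is_ratN1. Qed.

Lemma Constz_rat z : term_rat (qe_rcf.Const z%:~R).
Proof. exact: is_rat_int. Qed.

Hint Resolve Const0_rat ConstN1_rat Constz_rat NatConst_rat is_rat0 is_ratN1 is_rat_int is_rat_nat poly_rat_nil : core.

Lemma If_rat (c t e : qe_rcf.formula F) :
  qf_rat c -> qf_rat t -> qf_rat e -> qf_rat (If c t e).
Proof. by rewrite /If /=. Qed.

(** The elimination procedure is in continuation-passing style: the size or the leading coefficient
    of a polynomial depends on the values of the variables, so the continuation is placed in every
    branch. Hence the shape of these lemmas: if the continuation yields rational formulas on
    rational arguments, so does the whole. *)
Lemma Size_rat p k :
  poly_rat p -> (forall n, qf_rat (k n)) -> qf_rat (Size p k).
Proof.
elim: p k => [|c p IH] k //= /poly_rat_inv [hc hp] hk.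
by apply: IH => //; case => [|n] //=; repeat split.
Qed.

Lemma Isnull_rat p k :
  poly_rat p -> (forall b, qf_rat (k b)) -> qf_rat (Isnull p k).
Proof. by move=> hp hk; apply: Size_rat. Qed.

Lemma LeadCoef_rat p k :
  poly_rat p -> (forall t, term_rat t -> qf_rat (k t)) -> qf_rat (LeadCoef p k).
Proof.
elim: p k => [|c p IH] k /=; first by move=> _ hk; apply: hk; apply: Const_rat.
move=> /poly_rat_inv [hc hp] hk.
by apply: IH => // t ht /=; repeat split=> //; apply: hk.
Qed.

Lemma AmulXn_rat a n : term_rat a -> poly_rat (AmulXn a n).
Proof.
move=> ha; elim: n => [|n IH] /=; exact: poly_rat_cons.
Qed.

Lemma AddPoly_rat p q : poly_rat p -> poly_rat q -> poly_rat (AddPoly p q).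
Proof.
elim: p q => [|a p IH] [|b q] //= /poly_rat_inv [ha hp] /poly_rat_inv [hb hq].
by apply: poly_rat_cons => //=; apply: IH.
Qed.

Lemma ScalPoly_rat c p : term_rat c -> poly_rat p -> poly_rat (ScalPoly c p).
Proof.
move=> hc; elim: p => [|a p IH] //= /poly_rat_inv [ha hp].
by apply: poly_rat_cons => //=; apply: IH.
Qed.

Lemma MulPoly_rat p q : poly_rat p -> poly_rat q -> poly_rat (MulPoly p q).
Proof.
move=> + hq; elim: p => [|a p IH] //= /poly_rat_inv [ha hp].
apply: AddPoly_rat; first exact: ScalPoly_rat.
by apply: poly_rat_cons => //=; apply: IH.
Qed.

Lemma const_poly_rat c : term_rat c -> poly_rat [:: c].
Proof. by move=> hc; apply: poly_rat_cons. Qed.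

Hint Resolve const_poly_rat : core.

Lemma ExpPoly_rat p n : poly_rat p -> poly_rat (ExpPoly p n).
Proof.
move=> hp; rewrite /ExpPoly; case: n => [|n]; first exact: const_poly_rat.
rewrite iteropS; elim: n => [|n IH] //=; exact: MulPoly_rat.
Qed.

Lemma OppPoly_rat p : poly_rat p -> poly_rat (OppPoly p).
Proof. by move=> hp; apply: ScalPoly_rat => //=. Qed.

Lemma NatMulPoly_rat n p : poly_rat p -> poly_rat (NatMulPoly n p).
Proof. by move=> hp; apply: ScalPoly_rat. Qed.

Lemma Deriv_rat p : poly_rat p -> poly_rat (Deriv p).
Proof.
elim: p => [|a p IH] //= /poly_rat_inv [ha hp].
by apply: AddPoly_rat => //; apply: poly_rat_cons => //=; apply: IH.
Qed.

(** Pseudo-division multiplies by leading coefficients instead of dividing by them, so it introduces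
    integer constants only. *)
Lemma Rediv_rec_loop_rat q sq cq c qq r n k :
  poly_rat q -> term_rat cq -> poly_rat qq -> poly_rat r ->
  (forall c qq r, poly_rat qq -> poly_rat r -> qf_rat (k (c, qq, r))) ->
  qf_rat (Rediv_rec_loop q sq cq c qq r n k).
Proof.
move=> hq hcq hqq hr hk; elim: n c qq r hqq hr => [|n IH] c qq r hqq hr /=;
  apply: Size_rat => // sr; case: ifP => _; do ?exact: hk;
  apply: LeadCoef_rat => // t ht; [apply: hk | apply: IH];
  do ?[apply: AddPoly_rat | apply: MulPoly_rat | apply: AmulXn_rat
      | apply: OppPoly_rat | apply: const_poly_rat | done].
Qed.

Lemma Rediv_rat p q k :
  poly_rat p -> poly_rat q ->
  (forall c qq r, poly_rat qq -> poly_rat r -> qf_rat (k (c, qq, r))) ->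
  qf_rat (Rediv p q k).
Proof.
move=> hp hq hk; apply: Isnull_rat => // -[]; first by apply: hk => //; exact: const_poly_rat.
apply: Size_rat => // sq; apply: Size_rat => // sp; apply: LeadCoef_rat => // lq hlq.
by apply: Rediv_rec_loop_rat => //; exact: const_poly_rat.
Qed.

Lemma NextMod_rat p q k : poly_rat p -> poly_rat q ->
  (forall r, poly_rat r -> qf_rat (k r)) -> qf_rat (NextMod p q k).
Proof.
move=> hp hq hk; apply: LeadCoef_rat => // lq hlq.
apply: Rediv_rat => // c qq r0 hqq hr0; apply: Rediv_rat => // c1 q1 r hq1 hr.
by apply: hk; apply: ScalPoly_rat.
Qed.

Lemma Rgcd_loop_rat n p q k : poly_rat p -> poly_rat q ->
  (forall r, poly_rat r -> qf_rat (k r)) -> qf_rat (Rgcd_loop n p q k).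
Proof.
elim: n p q k => [|n IH] p q k hp hq hk /=; apply: Rediv_rat => // c1 q1 r hq1 hr;
  apply: Isnull_rat => // -[]; by [apply: hk | apply: IH].
Qed.

Lemma Rgcd_rat p q k : poly_rat p -> poly_rat q ->
  (forall r, poly_rat r -> qf_rat (k r)) -> qf_rat (Rgcd p q k).
Proof.
move=> hp hq hk; rewrite /Rgcd /LtSize /bind_def.
apply: Size_rat => // sp; apply: Size_rat => // sq.
by case: ifP => _; apply: Isnull_rat => // -[]; do ?exact: hk;
  apply: Size_rat => // n; apply: Rgcd_loop_rat.
Qed.

Lemma BigRgcd_rat ps k : polys_rat ps ->
  (forall r, poly_rat r -> qf_rat (k r)) -> qf_rat (BigRgcd ps k).
Proof.
elim: ps k => [|p ps IH] k; first by move=> _; apply; exact: const_poly_rat.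
by move=> /polys_rat_inv [hp hps] hk /=; apply: IH => // r hr; apply: Rgcd_rat.
Qed.

Lemma Changes_rat s k : poly_rat s ->
  (forall n, qf_rat (k n)) -> qf_rat (Changes s k).
Proof.
elim: s k => [|a s IH] k //= /poly_rat_inv [ha hs] hk.
apply: IH => // v; apply: If_rat => //=; repeat split=> //.
by case: s hs => //= b s /poly_rat_inv [].
Qed.

Lemma SeqPInfty_rat ps k : polys_rat ps ->
  (forall s, poly_rat s -> qf_rat (k s)) -> qf_rat (SeqPInfty ps k).
Proof.
elim: ps k => [|p ps IH] k; first by move=> _ hk; apply: hk; constructor.
move=> /polys_rat_inv [hp hps] hk /=; apply: LeadCoef_rat => // lp hlp.
by apply: IH => // s hs; apply: hk; apply: poly_rat_cons.
Qed.

Lemma SeqMInfty_rat ps k : polys_rat ps ->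
  (forall s, poly_rat s -> qf_rat (k s)) -> qf_rat (SeqMInfty ps k).
Proof.
elim: ps k => [|p ps IH] k; first by move=> _ hk; apply: hk; constructor.
move=> /polys_rat_inv [hp hps] hk /=; apply: LeadCoef_rat => // lp hlp.
apply: Size_rat => // n; apply: IH => // s hs; apply: hk.
by apply: poly_rat_cons.
Qed.

Lemma ChangesPoly_rat ps k : polys_rat ps ->
  (forall n, qf_rat (k n)) -> qf_rat (ChangesPoly ps k).
Proof.
move=> hps hk; apply: SeqMInfty_rat => // s hs; apply: SeqPInfty_rat => // s' hs'.
by apply: Changes_rat => // v; apply: Changes_rat.
Qed.

Lemma ModsAux_rat p q n k : poly_rat p -> poly_rat q ->
  (forall s, polys_rat s -> qf_rat (k s)) -> qf_rat (ModsAux p q n k).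
Proof.
elim: n p q k => [|n IH] p q k hp hq hk /=; first by apply: hk; constructor.
apply: Isnull_rat => // -[]; first by apply: hk; constructor.
apply: NextMod_rat => // r hr; apply: IH => // s hs.
by apply: hk; constructor.
Qed.

Lemma reducebig_rat (I : Type) (s : seq I) (f : I -> polyF F) :
  (forall i, poly_rat (f i)) ->
  poly_rat (reducebig [:: 1%:R%qfT] s (fun i => BigBody i (@MulPoly F) true (f i))).
Proof.
move=> hf; elim: s => [|i s IH] /=; first exact: const_poly_rat.
exact: MulPoly_rat.
Qed.

Lemma nth_polys_rat sq i : polys_rat sq -> poly_rat (nth [::] sq i).
Proof.
elim: sq i => [|p sq IH] [|i] //=; try by constructor.
- by move=> /polys_rat_inv [].
- by move=> /polys_rat_inv [_ h]; apply: IH.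
Qed.

Lemma PolyComb_rat sq sc : polys_rat sq -> poly_rat (PolyComb sq sc).
Proof.
by move=> h; apply: reducebig_rat => i; apply: ExpPoly_rat; apply: nth_polys_rat.
Qed.

Lemma Pcq_rat sq i : polys_rat sq -> poly_rat (Pcq sq i).
Proof.
move=> h; apply: nth_polys_rat; elim: (sg_tab _) => [|a s IH] /=; constructor => //.
exact: PolyComb_rat.
Qed.

(** The Tarski query of [q] on the roots of [p] is a difference of numbers of sign changes, at the
    two infinities, in the signed remainder sequence started from [p] and [p' q]. *)
Lemma TaqR_rat p q k : poly_rat p -> poly_rat q ->
  (forall n, qf_rat (k n)) -> qf_rat (TaqR p q k).
Proof.
move=> hp hq hk.
have hd : poly_rat (MulPoly (Deriv p) q) by apply: MulPoly_rat => //; apply: Deriv_rat.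
apply: Size_rat => // sp; apply: Size_rat => // sq.
by apply: ModsAux_rat => // s hs; apply: ChangesPoly_rat.
Qed.

Lemma TaqsR_rat p sq i k : poly_rat p -> polys_rat sq ->
  (forall t, term_rat t -> qf_rat (k t)) -> qf_rat (TaqsR p sq i k).
Proof.
move=> hp hsq hk; apply: TaqR_rat => //; first exact: Pcq_rat.
by move=> n; apply: hk => /=.
Qed.

(** This is where inverses enter. Roots satisfying sign conditions are counted from Tarski queries
    by solving a linear system; its matrix [ctmat] has integer entries, so its inverse has rational
    ones. The case of one condition is tabulated, with the constant 1/2. *)
Lemma Coefs_rat n i : term_rat (Coefs F n i).
Proof.
rewrite /Coefs /=; case: n => [|[|n]] //=.
- have half : is_rat (2%:R^-1) by exists (2%:R^-1); rewrite (fmorphV (@ratr F)) rmorph_nat.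
  by case: i => [|[|[|i]]] //=; rewrite nth_nil.
- rewrite /coefs; set s := [seq _ | _ <- _].
  suff H x : x \in s -> is_rat x.
    have [lt|ge] := ltnP i (size s); first by apply: H; apply: mem_nth.
    by rewrite nth_default.
  move=> /mapP [j _ ->].
  (* The same entry of the inverse computed over [rat]: a field morphism commutes with [invmx]. *)
  exists ((castmx (erefl _, exp3n _)
     (invmx (map_mx (intr : int -> rat) (ctmat n.+2)))) j ord0).
  rewrite !castmxE /=.
  set M := map_mx (intr : int -> rat) _.
  have -> : map_mx (intr : int -> F) (ctmat n.+2) = map_mx (ratr : rat -> F) M.
    by apply/matrixP => a b; rewrite !mxE ratr_int.
  by rewrite -map_invmx mxE.
Qed.

Lemma CcountWeak_rat p sq k : poly_rat p -> polys_rat sq ->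
  (forall t, term_rat t -> qf_rat (k t)) -> qf_rat (CcountWeak p sq k).
Proof.
move=> hp hsq hk; rewrite /CcountWeak.
have := NatConst_rat 0; move: (0%:R)%qfT; elim: (3 ^ size sq)%N => [|i IH] t ht.
  exact: hk.
apply: TaqsR_rat => // x hx; apply: IH => /=; repeat split=> //.
exact: Coefs_rat.
Qed.

Lemma BoundingPoly_rat sq : polys_rat sq -> poly_rat (BoundingPoly sq).
Proof.
move=> h; apply: Deriv_rat; elim: sq h => [|p sq IH] /=.
  by move=> _; exact: const_poly_rat.
by move=> /polys_rat_inv [hp hsq]; apply: MulPoly_rat => //; apply: IH.
Qed.

Lemma bigAnd_rat (T : Type) (P : T -> Prop) (s : seq T) (f : T -> qe_rcf.formula F) :
  List.Forall P s -> (forall t, P t -> qf_rat (f t)) ->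
  qf_rat (reducebig (qe_rcf.Bool true) s (fun q => BigBody q (@qe_rcf.And F) true (f q))).
Proof.
move=> hs hf; elim: s hs => [|a s IH] //= h; inversion h; subst.
by split; [apply: hf | apply: IH].
Qed.

(** A common root of the equations is a root of their gcd. If the gcd is null, a point where all of
    [sq] are positive is sought at both infinities and among the roots of [BoundingPoly], the
    derivative of their product. *)
Lemma CcountGt0_rat sp sq : polys_rat sp -> polys_rat sq -> qf_rat (CcountGt0 sp sq).
Proof.
move=> hsp hsq; apply: BigRgcd_rat => // p hp; apply: Isnull_rat => // -[] /=; last first.
  by apply: CcountWeak_rat.
apply: CcountWeak_rat => //; first exact: BoundingPoly_rat.
move=> t ht /=; repeat split => //; apply: (@bigAnd_rat _ poly_rat) => // q hq.
- by apply: LeadCoef_rat.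
- by apply: Size_rat => // n; apply: LeadCoef_rat.
Qed.

Lemma abstrX_rat i t : term_rat t -> poly_rat (abstrX i t).
Proof.
elim: t => /=.
- move=> n _; case: ifP => _; last exact: const_poly_rat.
  by apply: poly_rat_cons => //; exact: const_poly_rat.
- by move=> c hc; exact: const_poly_rat.
- by move=> n _; exact: const_poly_rat.
- by move=> u IHu v IHv [hu hv]; apply: AddPoly_rat; [apply: IHu | apply: IHv].
- by move=> u IHu hu; apply: OppPoly_rat; apply: IHu.
- by move=> u IHu n hu; apply: NatMulPoly_rat; apply: IHu.
- by move=> u IHu v IHv [hu hv]; apply: MulPoly_rat; [apply: IHu | apply: IHv].
- by move=> u IHu n hu; apply: ExpPoly_rat; apply: IHu.
Qed.

(** [Inv] here and [Unit] in [formula_rat] are excluded: the elimination is correct for formulas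
    built from ring operations, and expressions cannot divide by a variable quantity. *)
Fixpoint gterm_rat (t : GRing.term F) : Prop :=
  match t with
  | GRing.Var _ | GRing.NatConst _ => Logic.True
  | GRing.Const c => is_rat c
  | GRing.Add u v | GRing.Mul u v => gterm_rat u /\ gterm_rat v
  | GRing.Opp u | GRing.NatMul u _ | GRing.Exp u _ => gterm_rat u
  | GRing.Inv _ => Logic.False
  end.

Fixpoint formula_rat (f : ord.formula F) : Prop :=
  match f with
  | ord.Bool _ => Logic.True
  | ord.Equal u v | ord.Lt u v | ord.Le u v => gterm_rat u /\ gterm_rat v
  | ord.Unit _ => Logic.False
  | ord.And f g | ord.Or f g | ord.Implies f g => formula_rat f /\ formula_rat g
  | ord.Not f | ord.Exists _ f | ord.Forall _ f => formula_rat f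
  end.

Lemma to_rterm_rat t : gterm_rat t -> term_rat (to_rterm t).
Proof.
by elim: t => //= [u IHu v IHv|u IHu v IHv] [hu hv]; split; [apply: IHu|apply: IHv|apply: IHu|apply: IHv].
Qed.

Lemma rterm_to_term_rat t : term_rat t -> gterm_rat (rterm_to_term t).
Proof.
by elim: t => //= [u IHu v IHv|u IHu v IHv] [hu hv]; split; [apply: IHu|apply: IHv|apply: IHu|apply: IHv].
Qed.

Lemma qfr_to_formula_rat f : qf_rat f -> formula_rat (qfr_to_formula f).
Proof.
elim: f => //=; try by move=> f IHf g IHg [hf hg]; split; [apply: IHf | apply: IHg].
all: by move=> u v [hu hv]; split; apply: rterm_to_term_rat.
Qed.

Lemma gterm_rat_rterm t : gterm_rat t -> GRing.rterm t.
Proof.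
by elim: t => //= [u IHu v IHv|u IHu v IHv] [hu hv]; rewrite IHu ?IHv.
Qed.

Lemma formula_rat_rformula f : formula_rat f -> ord.rformula f.
Proof.
elim: f => //=; try by move=> f IHf g IHg [hf hg]; rewrite IHf ?IHg.
all: by move=> u v [hu hv]; rewrite !gterm_rat_rterm.
Qed.

Definition terms_rat : seq (GRing.term F) -> Prop := List.Forall gterm_rat.

Lemma wproj_rat n s : terms_rat s.1 -> terms_rat s.2 ->
  formula_rat (qfr_to_formula (wproj n s)).
Proof.
move=> h1 h2; apply: qfr_to_formula_rat.
have H (l : seq (GRing.term F)) : terms_rat l ->
    polys_rat [seq (abstrX n \o @to_rterm F) t | t <- l].
  elim: l => [|t l IH] h /=; first by constructor.
  inversion h; subst; constructor; last exact: IH.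
  by apply: abstrX_rat; apply: to_rterm_rat.
by apply: CcountGt0_rat; apply: H.
Qed.

Definition oclause_rat (oc : ord.oclause F) : Prop :=
  let: ord.Oclause a b c d := oc in
  [/\ terms_rat a, terms_rat b, terms_rat c & terms_rat d].

Lemma terms_rat_cat s t : terms_rat s -> terms_rat t -> terms_rat (s ++ t).
Proof. by move=> hs ht; apply/List.Forall_app. Qed.

Lemma and_odnf_rat b1 b2 :
  List.Forall oclause_rat b1 -> List.Forall oclause_rat b2 ->
  List.Forall oclause_rat (ord.and_odnf b1 b2).
Proof.
rewrite /ord.and_odnf => h1 h2; elim: b1 h1 => [|c1 b1 IH] h1.
  by rewrite big_nil; constructor.
inversion h1; subst; rewrite big_cons; apply/List.Forall_app; split; last exact: IH.
move: H1 => {IH H2 h1} hc1; elim: b2 h2 => [|c2 b2 IH] h2 /=; first by constructor.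
inversion h2; subst; constructor; last exact: IH.
case: c1 hc1 {IH} => a1 a2 a3 a4; case: c2 {h2} H1 => a5 a6 a7 a8 /= [????] [????].
by split; apply: terms_rat_cat.
Qed.

Lemma qf_to_odnf_rat f neg : formula_rat f ->
  List.Forall oclause_rat (ord.qf_to_odnf f neg).
Proof.
have t1 t : gterm_rat t -> terms_rat [:: t] by repeat constructor.
have tnil : terms_rat [::] by constructor.
elim: f neg => //=.
- by move=> b neg _; case: ifP => _; repeat constructor.
- by move=> u v neg [hu hv]; case: neg; repeat constructor.
- by move=> u v neg [hu hv]; case: neg; repeat constructor.
- by move=> u v neg [hu hv]; case: neg; repeat constructor.
- move=> f IHf g IHg neg [/IHf hf /IHg hg]; case: neg; last exact: and_odnf_rat.
  by apply/List.Forall_app.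
- move=> f IHf g IHg neg [/IHf hf /IHg hg]; case: neg; first exact: and_odnf_rat.
  by apply/List.Forall_app.
- move=> f IHf g IHg neg [/IHf hf /IHg hg]; case: neg; first exact: and_odnf_rat.
  by apply/List.Forall_app.
- by move=> f IHf neg /IHf.
- by move=> i f IHf neg _; case: neg; repeat constructor.
- by move=> i f IHf neg _; case: neg; repeat constructor.
Qed.

Lemma leq_elim_aux_rat a b c : terms_rat a -> terms_rat b -> terms_rat c ->
  List.Forall (fun x => terms_rat x.1 /\ terms_rat x.2) (ord.leq_elim_aux a b c).
Proof.
move=> ha hb; elim: c => [|t c IH] h /=; first by repeat constructor.
inversion h; subst; have {}IH := IH H2.
by apply/List.Forall_app; split; apply/List.Forall_map;
  apply: List.Forall_impl IH => -[x y] [hx hy] /=; split=> //; constructor.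
Qed.

Lemma neq_elim_aux_rat a b : terms_rat a -> terms_rat b ->
  List.Forall terms_rat (ord.neq_elim_aux a b).
Proof.
move=> ha; elim: b => [|t b IH] h /=; first by repeat constructor.
inversion h; subst; have {}IH := IH H2.
by apply/List.Forall_app; split; apply/List.Forall_map;
  apply: List.Forall_impl IH => x hx; constructor.
Qed.

(** Projection takes only equations and strict inequalities, so each non-strict inequality splits
    into an equation or a strict one, and each disequation into two strict ones. *)
Lemma oclause_to_w_rat oc : oclause_rat oc ->
  List.Forall (fun x => terms_rat x.1 /\ terms_rat x.2) (ord.oclause_to_w oc).
Proof.
case: oc => a b c d [ha hb hc hd]; rewrite /ord.oclause_to_w.
apply/List.Forall_map; rewrite /ord.oclause_neq_leq_elim /=.
elim: (ord.leq_elim_aux a c d) (leq_elim_aux_rat a c d ha hc hd) => [|[x y] s IH] h /=.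
  by constructor.
inversion h; subst; apply/List.Forall_app; split; last exact: IH.
case: H1 => hx hy; apply/List.Forall_map.
by apply: List.Forall_impl (neq_elim_aux_rat y b hy hb).
Qed.

Lemma bigOr_rat s : List.Forall formula_rat s ->
  formula_rat (foldr (@ord.Or F) (ord.Bool false) s).
Proof. by elim: s => //= f s IH h; inversion h; subst; split=> //; apply: IH. Qed.

Lemma proj_rat n oc : oclause_rat oc ->
  formula_rat (ord.proj (fun i s => qfr_to_formula (wproj i s)) n oc).
Proof.
move=> h; apply: bigOr_rat; apply/List.Forall_map.
by apply: List.Forall_impl (oclause_to_w_rat _ h) => -[x y] [hx hy]; apply: wproj_rat.
Qed.

Definition qelim : ord.formula F -> ord.formula F :=
  ord.quantifier_elim (fun i s => qfr_to_formula (wproj i s)).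

Lemma qelim_rat f : formula_rat f -> formula_rat (qelim f).
Proof.
have aux n g b : formula_rat g -> formula_rat (foldr (@ord.Or F) (ord.Bool false)
    (map (ord.proj (fun i s => qfr_to_formula (wproj i s)) n) (ord.qf_to_odnf g b))).
  move=> hg; apply: bigOr_rat; apply/List.Forall_map.
  have := qf_to_odnf_rat _ b hg; apply: List.Forall_impl => oc; exact: proj_rat.
rewrite /qelim; elim: f => //=.
- by move=> f IHf g IHg [/IHf hf /IHg hg].
- by move=> f IHf g IHg [/IHf hf /IHg hg].
- by move=> f IHf g IHg [/IHf hf /IHg hg].
- by move=> i f IHf /IHf hf; exact: aux.
- by move=> i f IHf /IHf hf; apply: aux.
Qed.

Lemma qelimP f e : formula_rat f ->
  ord.qf_form (qelim f) /\ (ord.holds e f <-> ord.qf_eval e (qelim f)).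
Proof.
move=> /formula_rat_rformula hf; split.
  by have /andP[] := ord.quantifier_elim_wf (@wf_QE_wproj F) hf.
have H := ord.quantifier_elim_rformP (@wf_QE_wproj F) (@valid_QE_wproj F) e hf.
by split=> [/H|/H].
Qed.

End RationalConstants.

(** * Predicates definable with rational constants *)

Section Definability.
Local Open Scope ring_scope.

Definition definable_fun (t : (nat -> R) -> R) : Prop :=
  exists u : GRing.term R, gterm_rat R u /\
    forall e : seq R, GRing.eval e u = t (nth 0 e).

(** Stated for predicates on environments, so that the closure lemmas follow the shape of [sumR],
    [dot] and [configuration], and no formula is ever written out. *)
Definition definable (P : (nat -> R) -> Prop) : Prop :=
  exists phi : ord.formula R, formula_rat R phi /\
    forall e : seq R, ord.holds e phi <-> P (nth 0 e).

Lemma definable_var i : definable_fun (fun rho => rho i).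
Proof. by exists (GRing.Var R i). Qed.

Lemma definable_zero : definable_fun (fun=> IZR 0).
Proof. by exists (GRing.NatConst R 0). Qed.

Lemma definable_add s t : definable_fun s -> definable_fun t ->
  definable_fun (fun rho => Rplus (s rho) (t rho)).
Proof.
move=> [u [hu eu]] [v [hv ev]]; exists (GRing.Add u v).
by split=> // e /=; rewrite eu ev.
Qed.

Lemma definable_sub s t : definable_fun s -> definable_fun t ->
  definable_fun (fun rho => Rminus (s rho) (t rho)).
Proof.
move=> [u [hu eu]] [v [hv ev]]; exists (GRing.Add u (GRing.Opp v)).
by split=> // e /=; rewrite eu ev RminusE.
Qed.

Lemma definable_mul s t : definable_fun s -> definable_fun t ->
  definable_fun (fun rho => Rmult (s rho) (t rho)).
Proof.
move=> [u [hu eu]] [v [hv ev]]; exists (GRing.Mul u v).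
by split=> // e /=; rewrite eu ev.
Qed.

Lemma definable_sumR N (t : nat -> (nat -> R) -> R) :
  (forall k, definable_fun (t k)) ->
  definable_fun (fun rho => sumR N (fun k => t k rho)).
Proof.
move=> ht; elim: N => [|N IH]; first exact: definable_zero.
exact: definable_add.
Qed.

Lemma definable_dot D (x y : nat -> (nat -> R) -> R) :
  (forall k, definable_fun (x k)) -> (forall k, definable_fun (y k)) ->
  definable_fun (fun rho => dot D (fun k => x k rho) (fun k => y k rho)).
Proof. by move=> hx hy; apply: definable_sumR => k; apply: definable_mul. Qed.

Lemma definable_le s t : definable_fun s -> definable_fun t ->
  definable (fun rho => Rle (s rho) (t rho)).
Proof.
move=> [u [hu eu]] [v [hv ev]]; exists (ord.Le u v); split=> // e /=.
by rewrite eu ev; split=> /RleP.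
Qed.

Lemma definable_eq s t : definable_fun s -> definable_fun t ->
  definable (fun rho => s rho = t rho).
Proof.
by move=> [u [hu eu]] [v [hv ev]]; exists (ord.Equal u v); split=> // e /=; rewrite eu ev.
Qed.

Lemma definable_within c s t : definable_fun s -> definable_fun t ->
  definable (fun rho => within c (s rho) (t rho)).
Proof. by move=> hs ht; case: c; apply: definable_le. Qed.

Lemma definable_and P Q : definable P -> definable Q ->
  definable (fun rho => P rho /\ Q rho).
Proof.
move=> [f [hf ef]] [g [hg eg]]; exists (ord.And f g).
by split=> // e /=; rewrite ef eg.
Qed.

Lemma definable_forall N (P : nat -> (nat -> R) -> Prop) :
  (forall i, definable (P i)) ->
  definable (fun rho => forall i, lt i N -> P i rho).
Proof.
move=> hP; elim: N => [|N [f [hf ef]]].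
  by exists (ord.Bool true); split=> // e; split=> // _ i /Nat.nlt_0_r.
have [g [hg eg]] := hP N; exists (ord.And f g); split=> // e /=.
rewrite ef eg; split=> [[h1 h2] i hi|h].
  by case: (Nat.eq_dec i N) => [->//|ne]; apply: h1; lia.
by split=> [i hi|]; apply: h; lia.
Qed.

Lemma definable_exists i P : definable P ->
  definable (fun rho => exists x, P (updR rho i x)).
Proof.
move=> [f [hf ef]]; exists (ord.Exists i f); split=> // e /=.
have E x : nth 0 (set_nth 0 e i x) = updR (nth 0 e) i x.
  apply: functional_extensionality => k; rewrite nth_set_nth /= /updR.
  by case: eqP => [->|ne]; [rewrite Nat.eqb_refl | rewrite (proj2 (Nat.eqb_neq _ _))].
by split=> -[x hx]; exists x; [rewrite -E -ef | rewrite ef E].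
Qed.

Lemma definable_block lo cnt P : definable P ->
  definable (fun rho => exists w, P (override lo cnt w rho)).
Proof.
move=> hP; elim: cnt => [|cnt IH].
  have [g [hg eg]] := hP; exists g; split=> // e; rewrite eg.
  have E w : override lo 0 w (nth 0 e) = nth 0 e.
    apply: functional_extensionality => k; rewrite /override.
    by case: Nat.leb_spec => //= h; case: Nat.ltb_spec => // h'; lia.
  by split=> [h|[w]]; [exists (nth 0 e); rewrite E | rewrite E].
(* The added quantifier binds the last variable of the block and stands outermost; the induction
   hypothesis binds the others. *)
have [g [hg eg]] := definable_exists (lo + cnt)%coq_nat _ IH.
exists g; split=> // e; rewrite eg.
have E w x rho : override lo cnt w (updR rho (lo + cnt)%coq_nat x) =
    override lo cnt.+1 (updR w (lo + cnt)%coq_nat x) rho.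
  apply: functional_extensionality => k; rewrite /override /updR.
  case: (Nat.eqb_spec k (lo + cnt)%coq_nat) => ne;
  case: Nat.leb_spec => h1; case: Nat.ltb_spec => h2; case: Nat.ltb_spec => h3 //=; lia.
split=> [[x [w h]]|[w h]].
  by exists (updR w (lo + cnt)%coq_nat x); rewrite -E.
exists (w (lo + cnt)%coq_nat); exists w; rewrite E.
suff -> : updR w (lo + cnt)%coq_nat (w (lo + cnt)%coq_nat) = w by [].
apply: functional_extensionality => k; rewrite /updR.
by case: Nat.eqb_spec => [->|].
Qed.

End Definability.

(** * From quantifier-free formulas to expressions *)

Section CompileFormula.
Local Open Scope ring_scope.

Definition env_of (ps : seq rexp) (ix : nat -> nat) (M : nat -> R) : seq R :=
  [seq denR p ix M | p <- ps].

Lemma rat_constant (q : rat) : exists z w, ratr q = IZR z / IZR (Zpos w) :> R.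
Proof.
have intE (z : int) : exists z', z%:~R = IZR z' :> R.
  case: z => n; first by exists (Z.of_nat n); rewrite -INR_IZR_INZ INRE.
  exists (Z.opp (Z.of_nat n.+1)); rewrite opp_IZR -INR_IZR_INZ INRE NegzE.
  by rewrite mulrNz.
have [z ez] := intE (numq q).
have [w ew] : exists w, (denq q)%:~R = IZR (Zpos w) :> R.
  case: (denq q) (denq_gt0 q) => // -[|n] // _.
  by exists (Pos.of_succ_nat n); rewrite -[Zpos _]/(Z.of_nat n.+1) -INR_IZR_INZ INRE.
by exists z, w; rewrite /ratr ez ew.
Qed.

(** A variable becomes the expression listed for it. Exponents and integer multiples are fixed by
    the term, so powers unroll into products and multiples become products by a constant. *)
Lemma compile_term (ps : seq rexp) (t : GRing.term R) : gterm_rat R t ->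
  exists r, forall ix M, denR r ix M = GRing.eval (env_of ps ix M) t.
Proof.
have natE n : IZR (Z.of_nat n) / IZR 1 = n%:R :> R.
  by rewrite -INR_IZR_INZ INRE R1E divr1.
elim: t => /=.
- move=> i _; exists (nth (RC 0 1) ps i) => ix M.
  have [lt|ge] := ltnP i (size ps); first by rewrite (nth_map (RC 0 1)).
  (* A variable beyond the list reads as 0 on both sides. *)
  rewrite !nth_default ?size_map //=.
  by rewrite RdivE R1E divr1.
- by move=> x [q ->]; have [z [w ->]] := rat_constant q; exists (RC z w) => ix M /=; rewrite RdivE.
- by move=> n _; exists (RC (Z.of_nat n) 1) => ix M /=; rewrite RdivE natE.
- move=> u IHu v IHv [/IHu [a ha] /IHv [b hb]]; exists (RPlus a b) => ix M /=.
  by rewrite ha hb.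
- move=> u IHu /IHu [a ha]; exists (RMinus (RC 0 1) a) => ix M /=.
  by rewrite ha RminusE RdivE mul0r sub0r.
- move=> u IHu n /IHu [a ha]; exists (RTimes a (RC (Z.of_nat n) 1)) => ix M /=.
  by rewrite ha RdivE RmultE natE mulr_natr.
- move=> u IHu v IHv [/IHu [a ha] /IHv [b hb]]; exists (RTimes a b) => ix M /=.
  by rewrite ha hb.
- by [].
- move=> u IHu n /IHu [a ha].
  elim: n => [|n [b hb]]; first by exists (RC 1 1) => ix M /=; rewrite RdivE divr1 expr0.
  by exists (RTimes a b) => ix M /=; rewrite ha hb exprS.
Qed.

Lemma compile_formula (ps : seq rexp) (f : ord.formula R) :
  ord.qf_form f -> formula_rat R f ->
  exists e, forall ix M, Nat.ltb 0 (denN e ix M) = ord.qf_eval (env_of ps ix M) f.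
Proof.
have ltE a b ix M : Nat.ltb 0 (denN (RLt a b) ix M) = (denR a ix M < denR b ix M).
  by apply/idP/RltP => [/ltb0_RLt|/ltb0_RLt].
elim: f => //=.
- by move=> b _ _; exists (NC b) => ix M; case: b.
- move=> u v _ [/(compile_term ps) [a ha] /(compile_term ps) [b hb]].
  (* Equality is the failure of both strict comparisons. *)
  exists (notE (orE (RLt a b) (RLt b a))) => ix M.
  by rewrite ltb0_notE ltb0_orE !ltE ha hb -neq_lt negbK.
- move=> u v _ [/(compile_term ps) [a ha] /(compile_term ps) [b hb]].
  by exists (RLt a b) => ix M; rewrite ltE ha hb.
- move=> u v _ [/(compile_term ps) [a ha] /(compile_term ps) [b hb]].
  by exists (notE (RLt b a)) => ix M; rewrite ltb0_notE ltE ha hb -leNgt.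
- move=> f IHf g IHg /andP[qf qg] [/(IHf qf) [a ha] /(IHg qg) [b hb]].
  by exists (andE a b) => ix M; rewrite ltb0_andE ha hb.
- move=> f IHf g IHg /andP[qf qg] [/(IHf qf) [a ha] /(IHg qg) [b hb]].
  by exists (orE a b) => ix M; rewrite ltb0_orE ha hb.
- move=> f IHf g IHg /andP[qf qg] [/(IHf qf) [a ha] /(IHg qg) [b hb]].
  by exists (orE (notE a) b) => ix M; rewrite ltb0_orE ltb0_notE ha hb implybE.
- move=> f IHf qf /(IHf qf) [a ha].
  by exists (notE a) => ix M; rewrite ltb0_notE ha.
Qed.

(** The expression is obtained before [ix] and [M] are known: one elimination serves all
    instances. *)
Lemma compile_definable (ps : seq rexp) (P : (nat -> R) -> Prop) : definable P ->
  exists e, forall ix M, lt 0 (denN e ix M) <-> P (nth 0 (env_of ps ix M)).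
Proof.
move=> [f [hf ef]]; have [qf _] := qelimP R f [::] hf.
have [e he] := compile_formula ps _ qf (qelim_rat R f hf).
exists e => ix M; have [_ H] := qelimP R f (env_of ps ix M) hf.
by rewrite -ef H -he -Nat.ltb_lt.
Qed.

End CompileFormula.

Lemma definable_configuration c m D : definable (configuration c m D).
Proof.
have hp i k : definable_fun (fun rho => rho (coord_var m D i k)) by exact: definable_var.
apply: definable_and; [|apply: definable_and].
- apply: definable_forall => i; apply: definable_forall => j.
  by apply: definable_eq; [apply: definable_dot | apply: definable_var].
- by apply: definable_le; [apply: definable_dot | apply: definable_var].
- apply: definable_forall => i; apply: definable_within; last exact: definable_var.
  by apply: definable_dot => k; apply: definable_sub.
Qed.

Lemma feasible_expression c m D (E2 : rexp) (G : nat -> nat -> rexp) (B : nat -> rexp) :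
  exists e, forall ix M, lt 0 (denN e ix M) <->
    feasible c m D (denR E2 ix M) (fun i j => denR (G i j) ix M)
      (fun i => denR (B i) ix M).
Proof.
(* The free variables of the formula are instantiated by the expressions for the squared radius, the
   Gram entries and the bounds. *)
pose param := parameter rexp m E2 G B.
have [e he] := compile_definable (mkseq param (free_vars m)) _
  (definable_block (free_vars m) (Nat.mul (S m) D) _ (definable_configuration c m D)).
exists e => ix M; rewrite he configuration_feasible.
have E k : lt k (free_vars m) ->
    nth (IZR 0) (env_of (mkseq param (free_vars m)) ix M) k = denR (param k) ix M.
  move=> /ssrnat.ltP hk.
  by rewrite (nth_map (RC 0 1)) ?size_mkseq // nth_mkseq.
have EG i j := parameter_gram rexp m E2 G B i j.
have EB i := parameter_bound rexp m E2 G B i.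
split; apply: feasible_ext => [|i j hi hj|i hi].
- exact: E (free_vars_pos m).
- by rewrite (E _ (gram_var_lt _ _ _ hi hj)) /param EG.
- by rewrite (E _ (bound_var_lt _ _ hi)) /param EB.
- by rewrite (E _ (free_vars_pos m)).
- by rewrite (E _ (gram_var_lt _ _ _ hi hj)) /param EG.
- by rewrite (E _ (bound_var_lt _ _ hi)) /param EB.
Qed.

(** Once [m] is fixed only finitely many dimensions occur, so their expressions can be gathered in
    one program. *)
Lemma decidable_control c m :
  poly_decides_fixed_m m (fun n m d eps f C V => possible c n m d eps f C V).
Proof.
have [FE hFE] := finite_choice nexp (NC 0) (S (S m))
  (fun D e => forall ix M, lt 0 (denN e ix M) <->
     feasible c m D (denR eps2E ix M) (fun i j => denR (gramE i j) ix M)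
       (fun i => denR (thresholdE c i) ix M))
  (fun D _ => feasible_expression c m D eps2E gramE (thresholdE c)).
exact: (algorithmE_correct c m FE hFE).
Qed.

Theorem theorem10 :
  forall m : nat,
    poly_decides_fixed_m m constructive_possible /\
    poly_decides_fixed_m m destructive_possible.
Proof. by move=> m; split; [exact: (decidable_control true) | exact: (decidable_control false)]. Qed.
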